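(* Fix a shape $\mathcal{C}$ and its (properly similar) standard indexing $\{\mathcal{C}_{\lambda}\}_{\lambda\in\mathbb{R}_{+}}$, i.e. $\mathcal{C}_\lambda = L_\lambda(\mathcal{C})$. Let $\ddot{\upsilon} := S(\mathcal{C})/A(\mathcal{C})$. (1) For each positive real number $\lambda$, let $\mathcal{D}_{\lambda}$ be the shape $\mathcal{C}_{\lambda\ddot{\upsilon}}$. Then $\{\mathcal{D}_{\lambda}\}_{\lambda\in\mathbb{R}_{+}}$ is a calculus-friendly properly similar indexing of this family of shapes. Moreover, $\mathcal{D}_{1}=\mathcal{C}_{\ddot{\upsilon}}$ is the unique shape $\mathcal{X}$ within the family $\{\mathcal{D}_{\lambda}\}_{\lambda\in\mathbb{R}_{+}}$ that satisfies $A(\mathcal{X})=S(\mathcal{X})$, and $\{\mathcal{D}_{\lambda}\}_{\lambda\in\mathbb{R}_{+}}$ is the standard indexing of the family of shapes similar to $\mathcal{D}_{1}$ (that is, $\mathcal{D}_\lambda = L_\lambda(\mathcal{D}_1)$ for all $\lambda \in \mathbb{R}_+$). (2) Now suppose $\{\mathcal{B}_{\lambda}\}_{\lambda\in\mathbb{R}_{+}}$ is another calculus-friendly properly similar indexing of a family of shapes such that for some positive real number $\kappa$ we have $\mathcal{B}_{\kappa}\cong\mathcal{C}$. Then, with $\mathcal{D}_\lambda = \mathcal{C}_{\lambda\ddot{\upsilon}}$ as in (1), $\mathcal{B}_{\lambda}\cong\mathcal{D}_{\lambda}$ for each positive real number $\lambda$, and $\lambda = A(\mathcal{B}_{\lambda})/S(\mathcal{B}_{\lambda})$.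 (3) If $\mathcal{U}$ is any shape similar to $\mathcal{C}$ such that $A(\mathcal{U})=S(\mathcal{U})$, then $\mathcal{U}\cong\mathcal{D}_{1}=\mathcal{C}_{\ddot{\upsilon}}$.
   Context: $\mathbb{R}_{+}$ denotes the set of positive real numbers. A curve $[a,b]\to\mathbb{R}^2$, $t\mapsto(x(t),y(t))$, is nicely rectifiable if it is continuously differentiable on $[a,b]$ (one-sided derivatives at the endpoints) and $x'(t),y'(t)$ never vanish simultaneously; it is piecewise nice if it is continuous and there is a partition $a=a_0<a_1<\cdots<a_n=b$ such that its restriction to each $[a_{i-1},a_i]$ is nicely rectifiable. A shape $\mathcal{C}$ is a piecewise nice simple closed curve in the Euclidean plane $\mathbb{R}^2$; it is identified with its image. For a shape $\mathcal{C}$, the region $R(\mathcal{C})$ enclosed by $\mathcal{C}$ is the union of $\mathcal{C}$ and the bounded component of $\mathbb{R}^2\setminus\mathcal{C}$. The area is $A(\mathcal{C}) := \iint_{R(\mathcal{C})}1\,dx\,dy$. The perimeter is $P(\mathcal{C}) := \sum_{i=1}^n\int_{a_{i-1}}^{a_i}\sqrt{x_{\mathcal{C}}'(t)^2+y_{\mathcal{C}}'(t)^2}\,dt$ (where the subintervals correspond to the nicely rectifiable pieces), and the semiperimeter is $S(\mathcal{C}) := \tfrac12P(\mathcal{C})$. A rigid motion of $\mathbb{R}^2$ is a composition of a rotation about the origin, possibly followed by a reflection across a line through the origin, followed by a translation. Shapes $\mathcal{C},\mathcal{D}$ are congruent, $\mathcal{C}\cong\mathcal{D}$, if $\mathcal{D}=M(\mathcal{C})$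 for some rigid motion $M$. For $\lambda\in\mathbb{R}_+$, $L_\lambda:\mathbb{R}^2\to\mathbb{R}^2$ is the scaling $L_\lambda(x,y)=(\lambda x,\lambda y)$. A shape $\mathcal{D}$ is $\lambda$-similar to $\mathcal{C}$, written $\mathcal{C}\sim_\lambda\mathcal{D}$, if $\mathcal{D}=(L_\lambda\circ M)(\mathcal{C})$ for some rigid motion $M$; $\mathcal{C}$ and $\mathcal{D}$ are similar if $\mathcal{C}\sim_\kappa\mathcal{D}$ for some $\kappa\in\mathbb{R}_+$. A family of shapes $\{\mathcal{F}_\lambda\}_{\lambda\in\mathbb{R}_+}$ is properly similar (is a properly similar indexing) if $\mathcal{F}_\kappa\sim_{\mu/\kappa}\mathcal{F}_\mu$ for all $\kappa,\mu\in\mathbb{R}_+$. The standard indexing of the family of shapes similar to a shape $\mathcal{C}$ is $\{\mathcal{C}_\lambda\}_{\lambda\in\mathbb{R}_+}$ with $\mathcal{C}_\lambda:=L_\lambda(\mathcal{C})$. A properly similar indexing $\{\mathcal{F}_\lambda\}_{\lambda\in\mathbb{R}_+}$ is calculus-friendly if the functions $A(\lambda):=A(\mathcal{F}_\lambda)$ and $S(\lambda):=S(\mathcal{F}_\lambda)$ satisfy $A'(\lambda)=2S(\lambda)$ for all $\lambda\in\mathbb{R}_+$. *)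

(* Defs.v *)
From mathcomp Require Import all_boot all_order all_algebra.
From mathcomp Require Import all_classical all_reals all_analysis.
Import Order.TTheory GRing.Theory Num.Theory.
Import numFieldNormedType.Exports.

Set Implicit Arguments.
Unset Strict Implicit.
Unset Printing Implicit Defensive.

Local Open Scope classical_set_scope.
Local Open Scope ring_scope.

Section Shapes.
Variable R : realType.
Implicit Types (C D X : set (R * R)) (F : R -> set (R * R)).

(* Difference quotient at t along I. For I = `[c, d] with c < d, its limit is
   the one-sided derivative at t = c and t = d, and the usual derivative at
   the interior points. *)
Definition quotient_within (I : set R) (f : R -> R) (t : R) :=
  (fun u => (f u - f t) / (u - t)) @ within I t^'.

Definition derivable_within (I : set R) (f : R -> R) (t : R) : Prop :=
  cvg (quotient_within I f t).

Definition deriv_within (I : set R) (f : R -> R) (t : R) : R :=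
  lim (quotient_within I f t).

Definition C1_within (I : set R) (f : R -> R) : Prop :=
  (forall t, I t -> derivable_within I f t) /\
  {within I, continuous (deriv_within I f)}.

Definition xcoord (g : R -> R * R) : R -> R := fun t => (g t).1.
Definition ycoord (g : R -> R * R) : R -> R := fun t => (g t).2.

Definition nicely_rectifiable (c d : R) (g : R -> R * R) : Prop :=
  [/\ C1_within `[c, d] (xcoord g),
      C1_within `[c, d] (ycoord g) &
      forall t, t \in `[c, d] ->
        ~ (deriv_within `[c, d] (xcoord g) t = 0 /\
           deriv_within `[c, d] (ycoord g) t = 0)].

(* The subdivision a = a_0 < a_1 < ... < a_n = b is given by the sequence
   s = [:: a_1; ...; a_n]. *)
Definition node (a b : R) (s : seq R) (i : nat) : R := nth b (a :: s) i.

Definition piecewise_nice (a b : R) (s : seq R) (g : R -> R * R) : Prop :=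
  [/\ {within `[a, b], continuous g},
      itv_partition a b s &
      forall i, (i < size s)%N ->
        nicely_rectifiable (node a b s i) (node a b s i.+1) g].

Definition simple_closed (a b : R) (g : R -> R * R) : Prop :=
  g a = g b /\ {in `[a, b[ &, injective g}.

Definition parametrizes (a b : R) (s : seq R) (g : R -> R * R) C : Prop :=
  [/\ a < b, piecewise_nice a b s g, simple_closed a b g &
      C = g @` `[a, b]].

Definition is_shape C : Prop := exists a b s g, parametrizes a b s g C.

(* By the Jordan curve theorem the complement of a shape has exactly one
   bounded component, so the second set is that component. *)
Definition region C : set (R * R) :=
  C `|` [set p | (~` C) p /\ bounded_set (connected_component (~` C) p)].

Definition area C : R :=
  \int[(@lebesgue_measure R \x @lebesgue_measure R)%E]_(p in region C) 1.

Definition speed (I : set R) (g : R -> R * R) (t : R) : R :=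
  Num.sqrt (deriv_within I (xcoord g) t ^+ 2
            + deriv_within I (ycoord g) t ^+ 2).

Definition arc_length (c d : R) (g : R -> R * R) : R :=
  \int[@lebesgue_measure R]_(t in `[c, d]) speed `[c, d] g t.

Definition curve_length (a b : R) (s : seq R) (g : R -> R * R) : R :=
  \sum_(0 <= i < size s) arc_length (node a b s i) (node a b s i.+1) g.

(* A shape is identified with its image: the perimeter is the length of a
   chosen piecewise nice parametrization (arc length does not depend on the
   choice). The default value 0 is only used for sets that are not shapes. *)
Definition perimeter C : R :=
  xget 0 [set l | exists a b s g,
                    parametrizes a b s g C /\ l = curve_length a b s g].

Definition semiperimeter C : R := perimeter C / 2.

Definition rotation (theta : R) (p : R * R) : R * R :=
  (cos theta * p.1 - sin theta * p.2, sin theta * p.1 + cos theta * p.2).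

(* Reflection across the line through the origin at angle phi. *)
Definition reflection (phi : R) (p : R * R) : R * R :=
  (cos (2 * phi) * p.1 + sin (2 * phi) * p.2,
   sin (2 * phi) * p.1 - cos (2 * phi) * p.2).

Definition translation (v p : R * R) : R * R := p + v.

Definition rigid_motion (M : R * R -> R * R) : Prop :=
  exists theta v,
    M = translation v \o rotation theta \/
    exists phi, M = translation v \o reflection phi \o rotation theta.

Definition scaling (lambda : R) (p : R * R) : R * R :=
  (lambda * p.1, lambda * p.2).

Definition congruent C D : Prop := exists2 M, rigid_motion M & D = M @` C.

Definition lambda_similar (lambda : R) C D : Prop :=
  exists2 M, rigid_motion M & D = (scaling lambda \o M) @` C.

Definition similar_shapes C D : Prop :=
  exists2 kappa, 0 < kappa & lambda_similar kappa C D.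

(* An indexing by the positive reals is a function on R of which only the
   values at positive arguments matter. *)
Definition shape_family F : Prop :=
  forall lambda, 0 < lambda -> is_shape (F lambda).

Definition members F : set (set (R * R)) :=
  [set F lambda | lambda in [set l : R | 0 < l]].

Definition properly_similar F : Prop :=
  shape_family F /\
  forall kappa mu, 0 < kappa -> 0 < mu ->
    lambda_similar (mu / kappa) (F kappa) (F mu).

Definition standard_indexing C : R -> set (R * R) :=
  fun lambda => scaling lambda @` C.

Definition calculus_friendly F : Prop :=
  properly_similar F /\
  forall lambda : R, 0 < lambda ->
    is_derive lambda 1 (fun l => area (F l)) (2 * semiperimeter (F lambda)).

End Shapes.

(* Main.v *)
Require Import Defs.
From mathcomp Require Import all_boot all_order all_algebra.
From mathcomp Require Import all_classical all_reals all_analysis.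
From mathcomp Require Import measurable_realfun ring lra.
Import Order.TTheory GRing.Theory Num.Theory.
Import numFieldNormedType.Exports.

(** The theorem rests on three scaling facts: under a similitude of ratio [k] a
shape is sent to a shape, its area is multiplied by [k^2], and its
semiperimeter by [k]; and on the positivity of the area [A] and the
semiperimeter [S] of a shape [C]. With these, an indexing by ratio
[l * u] of the family of [C] has area [(l * u)^2 A] and semiperimeter [l * u S],
so that the derivative of the area is twice the semiperimeter exactly when
[u = S / A], and area equals semiperimeter exactly when the ratio is [S / A].
Two similitudes of the same ratio differ by a rigid motion, which turns
equality of ratios into congruence.

Area. A similitude is an affine map; its effect on the product Lebesgue measure
comes from Fubini and the one-dimensional case, by factoring the map into a
shear in one coordinate and a shear in the other ([mu2_affine]). A similitude is
a homeomorphism, so it carries the enclosed region to the enclosed region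
([region_image]).

Perimeter. The length of a parametrization is the supremum of the lengths of its
inscribed polygons ([curve_has_length]). This supremum is intrinsic to a simple
closed curve: the edges of an inscribed polygon, slightly shortened, are chords
of pairwise disjoint connected subsets of the curve ([disjoint_chords]), and the
chords of such subsets always have total length at most the length of any
parametrization ([sum_chords_le]), since a connected subset of a simple closed
curve that contains two points contains one of the two arcs between them
([connected_contains_arc]). Hence two parametrizations of one curve have the
same length ([perimeterE]).

Positivity of the area. Some component of the complement must be bounded, which
is the separation part of the Jordan curve theorem ([shape_inside]). The winding
integral of [((x - u) dy - (y - v) dx) / ((x - u)^2 + (y - v)^2)] is locally
constant in [(u, v)] off the curve, and vanishes far from the curve, hence on
unbounded components: the difference of the integrands at two neighbouring
points, and the integrand at a distant point, have explicit arctangent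
primitives, whose increments cancel along the closed curve. On the other hand
the winding integral takes different values at two points lying close to each
other on the two sides of a smooth point of the curve ([winding_jump]), so one
of these two points lies in a bounded component. *)

Set Implicit Arguments.
Unset Strict Implicit.
Unset Printing Implicit Defensive.

Local Open Scope classical_set_scope.
Local Open Scope ring_scope.

(** * Similitudes of the plane *)

Section Similitudes.
Variable R : realType.
Implicit Types (a b e k l : R) (p v : R * R) (C D : set (R * R)).

(** The maps [z -> (a + ib) z + v] for [e = 1] and [z -> (a + ib) z^* + v] for
[e = -1], where [z = p.1 + i p.2]: every similitude of the plane has this form,
and the class is visibly stable under composition and inverse. *)
Definition simil a b e v p : R * R :=
  (a * p.1 - e * b * p.2 + v.1, b * p.1 + e * a * p.2 + v.2).

Definition similitude k (T : R * R -> R * R) : Prop :=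
  exists a b e v, [/\ e ^+ 2 = 1, a ^+ 2 + b ^+ 2 = k ^+ 2 & T = simil a b e v].

(** The arc cosine of [a] has sine [`|b|]; the sign of [b] decides between it and
its opposite. *)
Lemma angle_exists a b : a ^+ 2 + b ^+ 2 = 1 ->
  exists theta, cos theta = a /\ sin theta = b.
Proof.
move=> ab1.
have a1 : -1 <= a <= 1.
  rewrite -ler_norml -(@ler_pXn2r _ 2) ?nnegrE// real_normK ?num_real//.
  by rewrite expr1n -ab1 lerDl sqr_ge0.
have sq : Num.sqrt (1 - a ^+ 2) = `|b| by rewrite -ab1 addrAC subrr add0r sqrtr_sqr.
have [b0|b0] := leP 0 b.
  by exists (acos a); rewrite acosK// sin_acos// sq ger0_norm.
by exists (- acos a); rewrite cosN sinN acosK// sin_acos// sq ltr0_norm// opprK.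
Qed.

(** A rotation by [theta] followed by the reflection of angle [phi] is
[z -> exp (i (2 phi - theta)) z^*]. Conversely any [z -> c z^* + v] with
[`|c| = 1] is a single reflection followed by a translation. *)
Lemma rigid_motionP M : rigid_motion M <-> similitude 1 M.
Proof.
split.
- move=> [theta [v [->|[phi ->]]]].
    exists (cos theta), (sin theta), 1, v; rewrite !expr1n cos2Dsin2; split=> //.
    apply/funext => -[x y]; rewrite /simil /translation /rotation/=.
    by congr pair; rewrite /=; ring.
  exists (cos (2 * phi - theta)), (sin (2 * phi - theta)), (-1), v.
  rewrite !expr1n cos2Dsin2 sqrrN expr1n; split=> //.
  apply/funext => -[x y]; rewrite /simil /translation /rotation /reflection/=.
  by rewrite cosB sinB; congr pair; rewrite /=; ring.
- move=> [a [b [e [v [e1]]]]]; rewrite expr1n => /angle_exists[t [<- <-]] ->.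
  move/eqP: e1; rewrite -subr_eq0 subr_sqr_1 mulf_eq0 subr_eq0 addr_eq0.
  move=> /orP[]/eqP->.
    exists t, v; left; apply/funext => -[x y].
    by rewrite /simil /translation /rotation/=; congr pair; rewrite /=; ring.
  exists 0, v; right; exists (t / 2); apply/funext => -[x y].
  rewrite /simil /translation /rotation /reflection/= cos0 sin0.
  by rewrite (_ : 2 * (t / 2) = t); [congr pair; rewrite /=; ring|field].
Qed.

Lemma similitude_comp k l T U :
  similitude k T -> similitude l U -> similitude (k * l) (T \o U).
Proof.
move=> [a [b [e [v [e1 ab ->]]]]] [a' [b' [e' [v' [e'1 ab' ->]]]]].
exists (a * a' - e * b * b'), (b * a' + e * a * b'), (e * e'), (simil a b e v v').
split; first by rewrite exprMn e1 e'1 mulr1.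
  rewrite exprMn -ab -ab' !expr2 in e1 *; ring: e1.
apply/funext => -[x y]; rewrite /simil /=.
by rewrite !expr2 in e1; congr pair; rewrite /=; ring: e1.
Qed.

Lemma similitude_scaling k : similitude k (scaling k).
Proof.
exists k, 0, 1, 0; split; [by rewrite expr1n|by rewrite expr0n addr0|].
by apply/funext => -[x y]; rewrite /simil /scaling/=; congr pair; rewrite /=; ring.
Qed.

(** In complex notation the inverse of [w = c z + v] is [z = (w - v) / c], with a
conjugation of [c] and [w - v] when [e = -1]. *)
Lemma similitude_inv k T : 0 < k -> similitude k T ->
  exists U, [/\ similitude k^-1 U, cancel T U & cancel U T].
Proof.
move=> k0 [a [b [e [v [e1 ab ->]]]]].
have k2 : a ^+ 2 + b ^+ 2 != 0 by rewrite ab sqrf_eq0 gt_eqF.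
pose a' := a / (a ^+ 2 + b ^+ 2); pose b' := - e * b / (a ^+ 2 + b ^+ 2).
have k2' : a * a + b * b != 0 by rewrite -!expr2.
exists (simil a' b' e (simil (- a') (- b') e 0 v)); split.
- exists a', b', e, (simil (- a') (- b') e 0 v); split => //.
  rewrite exprVn -ab /a' /b' !expr2 in e1 *.
  by field: e1.
- move=> [x y]; rewrite /simil /a' /b' !expr2 /= in e1 *.
  by congr pair; rewrite /=; field: e1.
- move=> [x y]; rewrite /simil /a' /b' !expr2 /= in e1 *.
  by congr pair; rewrite /=; field: e1.
Qed.

(** A similitude of ratio [k] followed by the scaling of ratio [k^-1] is a rigid
motion. *)
Lemma lambda_similarP k C D : 0 < k ->
  lambda_similar k C D <-> exists2 T, similitude k T & D = T @` C.
Proof.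
move=> k0; split=> [[M /rigid_motionP rM ->]|[T kT ->]].
  exists (scaling k \o M) => //; rewrite -(mulr1 k).
  by apply: similitude_comp => //; rewrite mulr1; exact: similitude_scaling.
have kV : scaling k \o scaling k^-1 = id.
  apply/funext => -[x y]; rewrite /scaling/= !mulrA mulfV ?gt_eqF//.
  by rewrite !mul1r.
exists (scaling k^-1 \o T); last by rewrite -[_ \o (_ \o _)]/((_ \o _) \o T) kV.
apply/rigid_motionP; rewrite -[1](@mulVf _ k) ?gt_eqF//.
exact: similitude_comp (similitude_scaling _) kT.
Qed.

Lemma congruentP C D :
  congruent C D <-> exists2 T, similitude 1 T & D = T @` C.
Proof.
by split=> -[T rT ->]; exists T => //; apply/rigid_motionP.
Qed.

End Similitudes.

(** * Planar Lebesgue measure under affine maps *)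

Section PlaneMeasure.
Variable R : realType.
Local Notation mu := (@lebesgue_measure R).
Local Notation mu2 := (mu \x mu)%E.

(** A measure on the line is determined by its values on the intervals
[`]x, y]], where the identity can be read off the endpoints. *)
Lemma lebesgue_measure_affine (al be : R) (A : set R) :
    al != 0 -> measurable A ->
  (mu ((fun x : R => (al * x + be)%R) @^-1` A) = (`|al|^-1)%:E * mu A)%E.
Proof.
move=> al0 mA.
pose f : measurableTypeR R -> measurableTypeR R := fun x => al * x + be.
have mf : measurable_fun setT f.
  by apply: measurable_funD => //; exact: measurable_funM.
pose k : {nonneg R} := NngNum (normr_ge0 al).
have main B : measurable B -> (mu B = `|al|%:E * mu (f @^-1` B))%E.
  apply: (@lebesgue_measure_unique R (mscale k (pushforward mu f))) => //.
  move=> _ [[x y]] _ <-.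
  change (mu `]x, y] = `|al|%:E * mu (f @^-1` `]x, y]))%E.
  have [xy|yx] := ltP x y; last first.
    have -> : `]x, y]%classic = set0 :> set R by rewrite set_itv_ge// bnd_simp -leNgt.
    by rewrite preimage_set0 !measure0 mule0.
  have [al_gt|al_lt|/eqP] := ltgtP al 0; last by rewrite (negPf al0).
    have -> : f @^-1` `]x, y] = `[(y - be) / al, (x - be) / al[%classic.
      apply/seteqP; split=> z /=; rewrite !in_itv/= /f.
        rewrite ler_ndivrMr// ltr_ndivlMr// !(mulrC z).
        by move=> /andP[? ?]; apply/andP; split; lra.
      rewrite ler_ndivrMr// ltr_ndivlMr// !(mulrC z).
      by move=> /andP[? ?]; apply/andP; split; lra.
    rewrite !lebesgue_measure_itv/= !lte_fin xy ltr_ndivlMr// divfK//.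
    by rewrite ltrD2r xy -!EFinB -EFinM ltr0_norm//; congr EFin; field.
  have -> : f @^-1` `]x, y] = `](x - be) / al, (y - be) / al]%classic.
    apply/seteqP; split=> z /=; rewrite !in_itv/= /f.
      rewrite ltr_pdivrMr// ler_pdivlMr// !(mulrC z).
      by move=> /andP[? ?]; apply/andP; split; lra.
    rewrite ltr_pdivrMr// ler_pdivlMr// !(mulrC z).
    by move=> /andP[? ?]; apply/andP; split; lra.
  rewrite !lebesgue_measure_itv/= !lte_fin xy ltr_pdivrMr// divfK//.
  by rewrite ltrD2r xy -!EFinB -EFinM gtr0_norm//; congr EFin; field.
rewrite (main A mA).
by rewrite muleA -EFinM mulVf ?normr_eq0// mul1e.
Qed.

(** An open set is the countable union of the rational squares that it contains. *)
Lemma open_measurable2 (A : set (R * R)) : open A -> measurable A.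
Proof.
move=> oA.
pose box (i : rat * rat * rat) : set (R * R) :=
  `]ratr i.1.1 - ratr i.2, ratr i.1.1 + ratr i.2[ `*`
  `]ratr i.1.2 - ratr i.2, ratr i.1.2 + ratr i.2[.
have -> : A = \bigcup_i (if `[< box i `<=` A >] then box i else set0).
  apply/seteqP; split=> [p Ap|p [i _]]; last by case: asboolP => // bA /bA.
  have /nbhs_ballP[r /= r0 rA] : nbhs p A by exact: open_nbhs_nbhs.
  have [d] := rat_in_itvoo (divr_gt0 r0 (ltr0n R 2)).
  rewrite in_itv/= => /andP[d0 dr].
  have near_rat (x : R) : exists q : rat, `|x - ratr q| < ratr d.
    have [q] : exists q : rat, ratr q \in `]x - ratr d, x + ratr d[.
      by apply: rat_in_itvoo; lra.
    rewrite in_itv/= => /andP[? ?]; exists q.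
    by rewrite ltr_norml; apply/andP; split; lra.
  have [q1] := near_rat p.1; rewrite ltr_norml => /andP[q11 q12].
  have [q2] := near_rat p.2; rewrite ltr_norml => /andP[q21 q22].
  exists (q1, q2, d) => //; case: asboolP; last first.
    case; move=> [x y] []; rewrite /= !in_itv/= => /andP[? ?] /andP[? ?].
    by apply: rA; split; rewrite /ball/= ltr_norml; apply/andP; split; lra.
  by move=> _; split; rewrite /= in_itv/=; apply/andP; split; lra.
apply: countable_bigcupT_measurable => [|i]; first exact: countableP.
by case: asboolP => // _; exact: measurableX.
Qed.

Lemma measurable_affine_snd (al c d : R) :
  measurable_fun setT (fun p : R * R => (p.1, al * p.2 + (c * p.1 + d))).
Proof.
apply: measurable_fun_pair => //; apply: measurable_funD.
  exact: measurable_funM.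
apply: measurable_funD => //; exact: measurable_funM.
Qed.

(** By Fubini: on each vertical line the map is an affine map of the line. *)
Lemma mu2_affine_snd (al c d : R) (A : set (R * R)) : al != 0 ->
  measurable A ->
  (mu2 ((fun p : R * R => (p.1, (al * p.2 + (c * p.1 + d))%R)) @^-1` A) =
   (`|al|^-1)%:E * mu2 A)%E.
Proof.
move=> al0 mA; rewrite /product_measure1.
rewrite -ge0_integralZl//; last exact: measurable_fun_xsection.
apply: eq_integral => x _ /=.
by rewrite -(lebesgue_measure_affine (c * x + d))//; exact: measurable_xsection.
Qed.

Lemma mu2_swap (A : set (R * R)) : measurable A ->
  mu2 ((fun p : R * R => (p.2, p.1)) @^-1` A) = mu2 A.
Proof.
move=> mA.
pose f (p : measurableTypeR R * measurableTypeR R) :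
  measurableTypeR R * measurableTypeR R := (p.2, p.1).
have mf : measurable_fun setT f by exact: measurable_fun_pair.
symmetry; have := @product_measure_unique _ _ _ _ R mu mu (pushforward mu2 f).
apply=> // B B' mB mB'.
rewrite /pushforward/= muleC -product_measure1E//; congr (mu2 _).
by apply/seteqP; split=> -[x y] /= [].
Qed.

Lemma measurable_affine (a b c d u v : R) :
  measurable_fun setT
    (fun p : R * R => (a * p.1 + b * p.2 + u, c * p.1 + d * p.2 + v)).
Proof.
by apply: measurable_fun_pair; apply: measurable_funD => //;
  apply: measurable_funD; exact: measurable_funM.
Qed.

(** When [a != 0], the map factors through [(x, y) -> (a x + b y + u, y)] and
[(x', y) -> (x', (c / a) x' + (D / a) y + cst)], where [D] is the determinant;
each factor changes one coordinate only. When [a = 0], exchanging the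
coordinates first reduces to that case. *)
Lemma mu2_affine (a b c d u v : R) (A : set (R * R)) :
    a * d - b * c != 0 -> measurable A ->
  mu2 ((fun p : R * R => (a * p.1 + b * p.2 + u, c * p.1 + d * p.2 + v)%R)
         @^-1` A) =
  ((`|a * d - b * c|^-1)%:E * mu2 A)%E.
Proof.
wlog a0 : a b c d / a != 0.
  move=> wlg D0 mA; have [a0|a0] := eqVneq a 0; last exact: wlg.
  have b0 : b != 0.
    by apply: contraNneq D0 => ->; rewrite a0 !mul0r subrr.
  rewrite -mu2_swap; last first.
    by rewrite -[X in measurable X]setTI; exact: measurable_affine.
  rewrite -normrN opprB -(wlg b a d c)//; last by rewrite -oppr_eq0 opprB.
  congr (mu2 _); apply/funext => -[x y].
  by rewrite /preimage/= (addrC (a * _)) (addrC (c * _)).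
move=> D0 mA.
pose T1 (p : R * R) := (p.1, (a * d - b * c) / a * p.2 + (c / a * p.1 + (v - c / a * u))).
pose T2 (p : R * R) := (p.1, a * p.2 + (b * p.1 + u)).
have mT1 : measurable (T1 @^-1` A).
  by rewrite -[X in measurable X]setTI; exact: measurable_affine_snd.
have mT1' : measurable ((fun p : R * R => (p.2, p.1)) @^-1` (T1 @^-1` A)).
  by rewrite -[X in measurable X]setTI; exact: measurable_fun_pair.
transitivity (mu2 ((fun p : R * R => (p.2, p.1)) @^-1`
    (T2 @^-1` ((fun p : R * R => (p.2, p.1)) @^-1` (T1 @^-1` A))))).
  congr (mu2 _); apply/funext => -[x y].
  by rewrite /preimage /T1 /T2/=; congr (A _); congr pair; field.
rewrite mu2_swap; last first.
  by rewrite -[X in measurable X]setTI; exact: measurable_affine_snd.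
rewrite mu2_affine_snd// mu2_swap// mu2_affine_snd//; last first.
  by rewrite mulf_neq0// invr_eq0.
rewrite muleA -EFinM; congr (EFin _ * _)%E.
by rewrite normrM normfV; field; rewrite !normr_eq0 a0 D0.
Qed.

End PlaneMeasure.

(** * The enclosed region and its area *)

Section Region.
Variable R : realType.
Implicit Types (C B : set (R * R)) (p q : R * R) (T U : R * R -> R * R).
Local Notation mu := (@lebesgue_measure R).
Local Notation mu2 := (mu \x mu)%E.

Lemma bounded_setP B :
  bounded_set B <-> exists M, forall p, B p -> `|p.1| <= M /\ `|p.2| <= M.
Proof.
split=> [[M [_ bM]]|[M bM]].
  have M1 : M < M + 1 by rewrite ltrDl.
  exists (M + 1) => p Bp; have := bM (M + 1) M1 p Bp.
  by rewrite /= prod_normE ge_max => /andP.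
exists M; split; first exact: num_real.
move=> x Mx p /bM[b1 b2]; rewrite /= prod_normE ge_max.
by rewrite !(le_trans _ (ltW Mx)).
Qed.

Lemma similitude_continuous k T : similitude k T -> continuous T.
Proof.
move=> [a [b [e [v [_ _ ->]]]]] p.
apply: (@cvg_pair _ _ _ _ (nbhs (a * p.1 - e * b * p.2 + v.1))
          (nbhs (b * p.1 + e * a * p.2 + v.2))).
  apply: cvgD; last exact: cvg_cst.
  by apply: cvgB; apply: cvgMr; [exact: cvg_fst|exact: cvg_snd].
apply: cvgD; last exact: cvg_cst.
by apply: cvgD; apply: cvgMr; [exact: cvg_fst|exact: cvg_snd].
Qed.

Lemma similitude_bounded k T B :
  similitude k T -> bounded_set B -> bounded_set (T @` B).
Proof.
move=> [a [b [e [v [_ _ ->]]]]] /bounded_setP[M BM]; apply/bounded_setP.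
exists ((`|a| + `|e * b| + `|b| + `|e * a|) * `|M| + (`|v.1| + `|v.2|)).
move=> _ [p /BM[p1 p2] <-]; rewrite /simil/=.
have [p1' p2'] : `|p.1| <= `|M| /\ `|p.2| <= `|M|.
  by rewrite !(le_trans _ (ler_norm M)).
split.
  rewrite (le_trans (ler_normD _ _))// lerD ?lerDl//.
  rewrite (le_trans (ler_normB _ _))// !normrM !mulrDl -!addrA lerD//.
    by rewrite ler_wpM2l.
  by rewrite -[leLHS]addr0 lerD// ?ler_wpM2l// ?mulr_ge0// addr_ge0// mulr_ge0.
rewrite (le_trans (ler_normD _ _))// lerD ?lerDr//.
rewrite (le_trans (ler_normD _ _))// !normrM !mulrDl -!addrA.
rewrite -[leLHS]add0r lerD// ?mulr_ge0// -[leLHS]add0r lerD// ?mulr_ge0//.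
by rewrite lerD// ler_wpM2l// ?mulr_ge0.
Qed.

(** The image of an interval under an affine map into the plane; used both for the
segments of a square and for rays going to infinity. *)
Lemma connected_line p q (I : set R) : is_interval I ->
  connected ((fun t : R => (p.1 + t * q.1, p.2 + t * q.2)) @` I).
Proof.
move=> /connected_intervalP cI; apply: connected_continuous_connected cI _.
apply: continuous_subspaceT => t.
apply: (@cvg_pair _ _ _ _ (nbhs (p.1 + t * q.1)) (nbhs (p.2 + t * q.2))).
  by apply: cvgD; [exact: cvg_cst|apply: cvgMl; exact: cvg_id].
by apply: cvgD; [exact: cvg_cst|apply: cvgMl; exact: cvg_id].
Qed.

(** A ball is star-shaped about its centre, so it lies in one component of any set
that contains it. *)
Lemma ball_component A p q (r : R) : ball p r `<=` A -> ball p r q ->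
  connected_component A p = connected_component A q.
Proof.
move=> bA [/= q1 q2]; apply: same_connected_component.
exists ((fun t : R => (p.1 + t * (q - p).1, p.2 + t * (q - p).2)) @` `[0, 1]);
  last first.
  exists 1; first by rewrite /= in_itv/= lexx ler01.
  by rewrite !mul1r/=; case: (q) => x y /=; congr pair; rewrite addrC subrK.
split; last by apply: connected_line; exact: interval_is_interval.
  exists 0; first by rewrite /= in_itv/= lexx ler01.
  by rewrite !mul0r !addr0; case: (p).
move=> y [t /=]; rewrite in_itv/= => /andP[t0 t1] <-; apply: bA.
have shrink (x z : R) : ball x r z -> ball x r (x + t * (z - x)).
  rewrite /ball/= distrC => xy; rewrite opprD addrA subrr sub0r normrN normrM.
  by rewrite ger0_norm// (le_lt_trans _ xy)// ler_piMl.
by split; apply: shrink.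
Qed.

(** The complement consists of the points off [C] in an unbounded component; a
ball around such a point that avoids [C] stays in the same component. *)
Lemma region_closed C : compact C -> closed (region C).
Proof.
move=> cC; rewrite -[region C]setCK; apply: open_closedC.
have oC : open (~` C) by apply: closed_openC; apply: compact_closed cC; exact: norm_hausdorff.
rewrite openE => p /not_orP[Cp unb].
have /nbhs_ballP[r /= r0 rC] : nbhs p (~` C) by exact: open_nbhs_nbhs.
apply/nbhs_ballP; exists r => // q rq; apply/not_orP; split; first exact: rC.
move=> [Cq]; rewrite -(ball_component rC rq) => b; exact: unb.
Qed.

(** Outside a square centred at the origin that contains [C], the radial ray from a
point to infinity avoids [C], so the component of this point is unbounded. *)
Lemma region_bounded C : compact C -> bounded_set (region C).
Proof.
move=> /compact_bounded/bounded_setP[M CM]; apply/bounded_setP.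
exists `|M| => p; have [//|far] := pselect (`|p.1| <= `|M| /\ `|p.2| <= `|M|).
have ray (t : R) : 1 <= t -> (~` C) (0 + t * p.1, 0 + t * p.2).
  move=> t1 /CM; rewrite !add0r/= !normrM ger0_norm ?(le_trans ler01)// => -[p1 p2].
  have sh x : t * `|x| <= M -> `|x| <= `|M|.
    by move=> tx; rewrite (le_trans _ (ler_norm _))// (le_trans _ tx)// ler_peMl.
  by apply: far; split; exact: sh.
move=> [Cp|[Cp /bounded_setP[N compN]]].
  by have := ray 1 (lexx _); rewrite !add0r !mul1r; case: (p) Cp.
have comp (t : R) : 1 <= t ->
    connected_component (~` C) p (0 + t * p.1, 0 + t * p.2).
  move=> t1; exists ((fun t : R => (0 + t * p.1, 0 + t * p.2)) @` `[1, +oo[).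
    split; last by apply: (@connected_line 0); exact: interval_is_interval.
      exists 1; first by rewrite /= in_itv/= lexx.
      by rewrite !add0r !mul1r; case: (p).
    by move=> y [s /=]; rewrite in_itv/= andbT => /ray + <-.
  by exists t => //; rewrite /= in_itv/= t1.
have N0 : 0 <= N by have [+ _] := compN _ (comp 1 (lexx _)); exact: le_trans.
have unbd x : x != 0 -> exists2 t, 1 <= t & N < `|t * x|.
  move=> x0; have nx : 0 < `|x| by rewrite normr_gt0.
  exists (1 + N / `|x|); first by rewrite lerDl divr_ge0.
  rewrite normrM ger0_norm ?addr_ge0// ?divr_ge0// mulrDl mul1r divfK ?gt_eqF//.
  by rewrite ltrDr.
have [p1|/unbd[t t1 Nt]] := eqVneq p.1 0; last first.
  by have [] := compN _ (comp t t1); rewrite /= add0r leNgt Nt.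
have [p2|/unbd[t t1 Nt]] := eqVneq p.2 0; last first.
  by have [_] := compN _ (comp t t1); rewrite /= add0r leNgt Nt.
by exfalso; apply: far; rewrite p1 p2 normr0.
Qed.

(** The inverse similitude maps the component of [T p] into the component of [p],
and similitudes preserve boundedness. *)
Lemma region_image_sub k T C : 0 < k -> similitude k T ->
  T @` region C `<=` region (T @` C).
Proof.
move=> k0 sT; have [U [sU TU UT]] := similitude_inv k0 sT.
move=> _ [p [Cp|[Cp bp]] <-]; first by left; exists p.
right; split.
  by move=> [q Cq /(congr1 U)]; rewrite !TU => qp; apply: Cp; rewrite -qp.
set B := connected_component _ _.
suff /(similitude_bounded sT) : bounded_set (U @` B).
  by rewrite image_comp (_ : T \o U = id) ?image_id//; exact/funext.
have sub : U @` B `<=` connected_component (~` C) p.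
  apply: connected_component_max.
  - exists (T p); last exact: TU.
    apply: connected_component_refl.
    by move=> [q Cq /(congr1 U)]; rewrite !TU => qp; apply: Cp; rewrite -qp.
  - move=> _ [q Bq <-] CUq.
    have := connected_component_sub Bq; apply; exists (U q) => //; exact: UT.
  - apply: connected_continuous_connected; first exact: component_connected.
    by apply: continuous_subspaceT; exact: similitude_continuous sU.
move/bounded_setP : bp => [M bM]; apply/bounded_setP; exists M => q /sub.
exact: bM.
Qed.

Lemma region_image k T C : 0 < k -> similitude k T ->
  region (T @` C) = T @` region C.
Proof.
move=> k0 sT; apply/seteqP; split; last exact: region_image_sub k0 sT.
have [U [sU TU UT]] := similitude_inv k0 sT.
have kV0 : 0 < k^-1 by rewrite invr_gt0.
move=> p rp; exists (U p); last exact: UT.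
have := @region_image_sub _ _ (T @` C) kV0 sU (U p); rewrite image_comp.
rewrite (_ : U \o T = id) ?image_id; last exact/funext.
by apply; exists p.
Qed.

Lemma region_measurable C : compact C -> measurable (region C).
Proof.
move=> cC; rewrite -[region C]setCK; apply: measurableC; apply: open_measurable2.
by apply: closed_openC; exact: region_closed.
Qed.

Lemma areaE C : compact C -> area C = fine (mu2 (region C)).
Proof.
by move=> cC; rewrite /area Rintegral_cst ?mul1r//; exact: region_measurable.
Qed.

Lemma mu2_box (a b r : R) : 0 < r ->
  mu2 (`]a - r, a + r[ `*` `]b - r, b + r[) = ((2 * r) ^+ 2)%:E.
Proof.
move=> r0; rewrite product_measure1E//= !lebesgue_measure_itv/= !lte_fin.
have ltr (x : R) : x - r < x + r by lra.
rewrite !ltr -!EFinB -EFinM; congr EFin; ring.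
Qed.

Lemma mu2_region_lty C : compact C -> (mu2 (region C) < +oo)%E.
Proof.
move=> cC; have /bounded_setP[M bM] := region_bounded cC.
have M0 : 0 < `|M| + 1 by rewrite ltr_wpDl.
rewrite (@le_lt_trans _ _ (mu2 (`]0 - (`|M| + 1), 0 + (`|M| + 1)[
    `*` `]0 - (`|M| + 1), 0 + (`|M| + 1)[)))//; last by rewrite mu2_box// ltry.
apply: le_measure; rewrite ?inE; first exact: region_measurable.
  exact: measurableX.
move=> p /bM[p1 p2]; have := ler_norm M.
move: p1 p2; rewrite !ler_norml => /andP[? ?] /andP[? ?] ?.
by split; rewrite /= in_itv/=; apply/andP; split; lra.
Qed.

Lemma area_image k T C : 0 < k -> similitude k T -> compact C ->
  area (T @` C) = k ^+ 2 * area C.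
Proof.
move=> k0 sT cC.
have cT : compact (T @` C).
  apply: continuous_compact cC; apply: continuous_subspaceT.
  exact: similitude_continuous sT.
have mD := region_measurable cT; have fD := mu2_region_lty cT.
rewrite (areaE cT) (areaE cC).
have -> : region C = T @^-1` region (T @` C).
  rewrite (region_image _ k0 sT); apply/seteqP; split=> p; first by exists p.
  have [U [_ TU _]] := similitude_inv k0 sT.
  by move=> [q rq /(congr1 U)]; rewrite !TU => <-.
move: (region (T @` C)) mD fD => D mD fD.
have [a [b [e [v [e1 ab Teq]]]]] := sT.
have -> : T = fun p => (a * p.1 + (- (e * b)) * p.2 + v.1, b * p.1 + e * a * p.2 + v.2).
  by rewrite Teq; apply/funext => p; rewrite /simil mulNr.
have detE : a * (e * a) - - (e * b) * b = e * k ^+ 2 by rewrite -ab; ring.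
have ne : `|e| = 1.
  by apply/eqP; rewrite -(@pexpr_eq1 _ _ 2)// real_normK ?num_real// e1.
have nD : `|a * (e * a) - - (e * b) * b| = k ^+ 2.
  by rewrite detE normrM ne mul1r ger0_norm// exprn_ge0// ltW.
have D0 : a * (e * a) - - (e * b) * b != 0.
  by rewrite -normr_eq0 nD expf_neq0// gt_eqF.
rewrite (mu2_affine _ _ D0 mD) nD fineM//; last by rewrite ge0_fin_numE.
by rewrite mulrA mulfV ?mul1r// expf_neq0// gt_eqF.
Qed.

(** The region contains a square about [p]. *)
Lemma area_gt0 C p : compact C -> (~` C) p ->
  bounded_set (connected_component (~` C) p) -> 0 < area C.
Proof.
move=> cC Cp bp; rewrite areaE//.
have oC : open (~` C) by apply: closed_openC; apply: compact_closed cC; exact: norm_hausdorff.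
have /nbhs_ballP[r /= r0 rC] : nbhs p (~` C) by exact: open_nbhs_nbhs.
rewrite fine_gt0// mu2_region_lty// andbT.
apply: (@lt_le_trans _ _ (mu2 (`]p.1 - r, p.1 + r[ `*` `]p.2 - r, p.2 + r[))).
  by rewrite mu2_box// lte_fin exprn_gt0// mulr_gt0.
apply: le_measure; rewrite ?inE; [exact: measurableX|exact: region_measurable|].
move=> q [/=]; rewrite !in_itv/= => /andP[? ?] /andP[? ?].
have rq : ball p r q by split; rewrite /ball/= ltr_norml; apply/andP; split; lra.
by right; split; [exact: rC|rewrite /= -(ball_component rC rq)].
Qed.
End Region.

(** * Calculus on a compact interval *)

Section WithinContinuity.
Variable R : realType.
Implicit Types (I : set R) (f g : R -> R) (c d s t : R).
Local Notation mu := (@lebesgue_measure R).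

Lemma within_continuous_cst I (k : R) : {within I, continuous (fun _ : R => k)}.
Proof. by move=> t; exact: cvg_cst. Qed.

Lemma within_continuous_add I f g : {within I, continuous f} ->
  {within I, continuous g} -> {within I, continuous (fun t => f t + g t)}.
Proof. by move=> cf cg t; apply: cvgD; [exact: cf|exact: cg]. Qed.

Lemma within_continuous_sub I f g : {within I, continuous f} ->
  {within I, continuous g} -> {within I, continuous (fun t => f t - g t)}.
Proof. by move=> cf cg t; apply: cvgB; [exact: cf|exact: cg]. Qed.

Lemma within_continuous_mul I f g : {within I, continuous f} ->
  {within I, continuous g} -> {within I, continuous (fun t => f t * g t)}.
Proof. by move=> cf cg t; apply: cvgM; [exact: cf|exact: cg]. Qed.

Lemma within_continuous_div I f g : {within I, continuous f} ->
  {within I, continuous g} -> (forall t, I t -> g t != 0) ->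
  {within I, continuous (fun t => f t / g t)}.
Proof.
move=> cf cg g0; apply: within_continuous_mul => //.
apply: (@within_continuous_comp R R R I g (@GRing.inv R)) => // y.
by rewrite inE => -[t It <-]; apply: inv_continuous; exact: g0.
Qed.

Lemma within_continuous_postcomp I f (phi : R -> R) : continuous phi ->
  {within I, continuous f} -> {within I, continuous (fun t => phi (f t))}.
Proof.
by move=> cphi cf; apply: (@within_continuous_comp R R R I f phi) => // y _; exact: cphi.
Qed.

Lemma within_continuous_integrable c d s t f : {within `[c, d], continuous f} ->
  c <= s -> t <= d -> mu.-integrable `[s, t] (EFin \o f).
Proof.
move=> cf cs td; apply: continuous_compact_integrable.
  exact: segment_compact.
apply: continuous_subspaceW cf => u /=; rewrite !in_itv/= => /andP[su ut].
by rewrite (le_trans cs su) (le_trans ut td).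
Qed.

Lemma Rintegral_itv_split f s t u : s <= t -> t <= u ->
  mu.-integrable `[s, u] (EFin \o f) ->
  \int[mu]_(r in `[s, u]) f r =
  \int[mu]_(r in `[s, t]) f r + \int[mu]_(r in `[t, u]) f r.
Proof.
move=> st tu fi.
have := @Rintegral_itvB R f (BLeft s) (BRight u) t fi.
rewrite !bnd_simp => /(_ st tu).
rewrite Rintegral_itv_obnd_cbnd; last first.
  by apply: integrableS fi => //; exact: subset_itvr.
by move=> /eqP; rewrite subr_eq addrC => /eqP.
Qed.

Lemma Rintegral_itv_cst (k s t : R) : s <= t ->
  \int[mu]_(r in `[s, t]) k = k * (t - s).
Proof.
rewrite Rintegral_cst//= lebesgue_measure_itv/= lte_fin le_eqVlt.
by move=> /orP[/eqP->|->]; rewrite ?ltxx ?subrr//.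
Qed.

(** [f] is of class C1 on the segment with derivative [f']: the derivative relation
is only asked in the open interval, and continuity of [f] and [f'] determines
the one-sided derivatives at the ends. *)
Record C1_on c d f f' : Prop := C1_on_intro {
  C1_cont : {within `[c, d], continuous f};
  C1_cont' : {within `[c, d], continuous f'};
  C1_derive : forall t, c < t < d -> is_derive t 1 f (f' t) }.

Lemma FTC_C1_on c d f f' s t : C1_on c d f f' -> c <= s -> s <= t -> t <= d ->
  \int[mu]_(r in `[s, t]) f' r = f t - f s.
Proof.
move=> [cf cf' df] cs; rewrite le_eqVlt => /predU1P[<- _|st td].
  by rewrite set_itv1 Rintegral_set1 subrr.
have sub : `[s, t]%classic `<=` `[c, d]%classic.
  move=> u /=; rewrite !in_itv/= => /andP[su ut].
  by rewrite (le_trans cs su) (le_trans ut td).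
have dst u : u \in `]s, t[ -> is_derive u 1 f (f' u).
  rewrite in_itv/= => /andP[su ut]; apply: df.
  by rewrite (le_lt_trans cs su) (lt_le_trans ut td).
rewrite /Rintegral (@continuous_FTC2 _ f' f)//.
- exact: continuous_subspaceW cf'.
- have /(continuous_within_itvP _ st)[_ fs ft] := continuous_subspaceW sub cf.
  by split => // u /dst[].
- by move=> u /dst fu; rewrite derive1E derive_val.
Qed.

(** A nondegenerate segment accumulates at each of its points, so that limits of
difference quotients along it are unique. *)
Lemma within_dnbhs_proper c d t : c < d -> t \in `[c, d] ->
  ProperFilter (within `[c, d] t^').
Proof.
move=> cd tcd; apply: Build_ProperFilter_ex => A.
rewrite /within/= => /nbhs_ballP[r /= r0 rA].
move: tcd; rewrite in_itv/= => /andP[ct td].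
have [t_lt_d|] := ltP t d.
  exists (Num.min d (t + r / 2)); apply: rA.
  - rewrite /ball/= ltr_norml /Num.min; case: ifP => ?; apply/andP; split; lra.
  - by rewrite /Num.min; case: ifP => ?; rewrite gt_eqF//; lra.
  - by rewrite /= in_itv/= /Num.min; case: ifP => ?; apply/andP; split; lra.
move=> dt; exists (Num.max c (t - r / 2)); apply: rA.
- by rewrite /ball/= ltr_norml /Num.max; case: ifP => ?; apply/andP; split; lra.
- by rewrite /Num.max; case: ifP => ?; rewrite lt_eqF//; lra.
- by rewrite /= in_itv/= /Num.max; case: ifP => ?; apply/andP; split; lra.
Qed.

(** In the interior of the segment, the limit along the segment is the two-sided
limit, so it is the usual derivative. *)
Lemma C1_withinP c d f : c < d -> {within `[c, d], continuous f} ->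
  C1_within `[c, d] f -> C1_on c d f (deriv_within `[c, d] f).
Proof.
move=> cd cf [df cf']; split => // t /andP[ct td].
have tcd : `[c, d]%classic t by rewrite /= in_itv/= !ltW.
have /cvg_ex[/= l ql] := df t tcd.
have lE : deriv_within `[c, d] f t = l.
  by apply: cvg_lim => //; apply: within_dnbhs_proper.
suff lim : (fun h => h^-1 *: (f (h *: 1 + t) - f t)) @ 0^' --> l.
  rewrite lE; apply: DeriveDef; first by apply/cvg_ex; exists l.
  exact: cvg_lim.
move=> U /ql; rewrite /= /within/= => /nbhs_ballP[r /= r0 rU].
have m0 : 0 < Num.min r (Num.min (t - c) (d - t)) by rewrite !lt_min; apply/and3P; split; lra.
exists (Num.min r (Num.min (t - c) (d - t))) => //= h.
rewrite /ball/= sub0r normrN !lt_min => /and3P[hr hc hd] h0.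
have -> : h^-1 *: (f (h *: 1 + t) - f t) = (f (t + h) - f t) / ((t + h) - t).
  by rewrite /GRing.scale/= mulr1 (addrC h) [t + h - t]addrAC subrr add0r mulrC.
apply: rU.
- by rewrite /ball/= opprD addrA subrr sub0r normrN.
- by rewrite -subr_eq0 addrAC subrr add0r.
- rewrite /= in_itv/=; move: hc hd; rewrite !ltr_norml => /andP[? ?] /andP[? ?].
  by apply/andP; split; lra.
Qed.

End WithinContinuity.

Section C1Calculus.
Variables (R : realType) (c d : R).
Implicit Types (f g : R -> R).

Lemma C1_on_eq f (f' h' : R -> R) : C1_on c d f f' ->
  (forall t, c <= t <= d -> f' t = h' t) -> C1_on c d f h'.
Proof.
move=> [cf cf' df] E; split => //.
  apply: (@subspace_eq_continuous _ _ _ f') => // t.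
  by rewrite inE /= in_itv/= => /E.
move=> t /andP[ct td]; rewrite -E; first by apply: df; rewrite ct.
by rewrite !ltW.
Qed.

Lemma C1_on_cst (k : R) : C1_on c d (fun=> k) (fun=> 0).
Proof.
by split; [exact: within_continuous_cst|exact: within_continuous_cst|
  move=> t _; exact: is_derive_cst].
Qed.

Lemma C1_on_add f (f' : R -> R) g (g' : R -> R) : C1_on c d f f' -> C1_on c d g g' ->
  C1_on c d (fun t => f t + g t) (fun t => f' t + g' t).
Proof.
move=> [cf cf' df] [cg cg' dg]; split; try exact: within_continuous_add.
by move=> t tcd; have := df t tcd; have := dg t tcd => *; exact: is_deriveD.
Qed.

Lemma C1_on_mul f (f' : R -> R) g (g' : R -> R) : C1_on c d f f' -> C1_on c d g g' ->
  C1_on c d (fun t => f t * g t) (fun t => f t * g' t + g t * f' t).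
Proof.
move=> [cf cf' df] [cg cg' dg]; split; first exact: within_continuous_mul.
  by apply: within_continuous_add; exact: within_continuous_mul.
by move=> t tcd; have := df t tcd; have := dg t tcd => *; exact: is_deriveM.
Qed.

Lemma C1_on_div f (f' : R -> R) g (g' : R -> R) : C1_on c d f f' -> C1_on c d g g' ->
  (forall t, c <= t <= d -> g t != 0) ->
  C1_on c d (fun t => f t / g t)
    (fun t => (f' t * g t - f t * g' t) / (g t) ^+ 2).
Proof.
move=> [cf cf' df] [cg cg' dg] g0.
have g0' t : `[c, d]%classic t -> g t != 0 by rewrite /= in_itv; exact: g0.
split; first exact: within_continuous_div.
  apply: within_continuous_div => [||t /g0' gt]; last by rewrite expf_neq0.
    by apply: within_continuous_sub; exact: within_continuous_mul.
  exact: (within_continuous_postcomp (@exprn_continuous _ 2)).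
move=> t /[dup] /andP[ct td] tcd; have h1 := df t tcd; have h2 := dg t tcd.
have gt : g t != 0 by apply: g0; rewrite !ltW.
have h3 := is_deriveV gt h2; apply: is_derive_eq.
rewrite /GRing.scale/=; field; exact: gt.
Qed.

Lemma C1_on_atan f (f' : R -> R) : C1_on c d f f' ->
  C1_on c d (fun t => atan (f t)) (fun t => f' t / (1 + (f t) ^+ 2)).
Proof.
move=> [cf cf' df]; split.
- exact: (within_continuous_postcomp (@continuous_atan _)).
- apply: within_continuous_div => // [|t _].
    apply: within_continuous_add; first exact: within_continuous_cst.
    exact: (within_continuous_postcomp (@exprn_continuous _ 2)).
  by rewrite gt_eqF// ltr_pwDl// sqr_ge0.
- move=> t tcd; have h := df t tcd; apply: is_derive_eq.
  by rewrite mulrC.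
Qed.

End C1Calculus.

(** * Parametrizations under similitudes *)

Section Transport.
Variable R : realType.
Implicit Types (a b c d t : R) (s : seq R) (g : R -> R * R) (C : set (R * R)).
Local Notation mu := (@lebesgue_measure R).

Lemma node_bounds a b s i : itv_partition a b s -> (i < size s)%N ->
  [/\ a <= node a b s i, node a b s i < node a b s i.+1 &
      node a b s i.+1 <= b].
Proof.
move=> abs ils; split.
- by apply: itv_partition_nth_ge abs; rewrite ltnS ltnW.
- by have [/(pathP b) H _] := abs; exact: H.
- exact: itv_partition_nth_le.
Qed.

Lemma node_le (a b : R) s i j : itv_partition a b s -> (i <= j)%N ->
  (j <= size s)%N -> node a b s i <= node a b s j.
Proof.
move=> abs; elim: j => [|j ih]; first by rewrite leqn0 => /eqP->.
rewrite leq_eqVlt => /predU1P[->//|ij] js.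
have [_ lt _] := node_bounds abs js.
by rewrite (le_trans (ih ij (ltnW js)))// ltW.
Qed.

Lemma continuous_coords a b g : {within `[a, b], continuous g} ->
  {within `[a, b], continuous (xcoord g)} /\
  {within `[a, b], continuous (ycoord g)}.
Proof.
move=> cg; split.
  by apply: (@within_continuous_comp (R * R)%type R R _ g fst) => // p _; exact: cvg_fst.
by apply: (@within_continuous_comp (R * R)%type R R _ g snd) => // p _; exact: cvg_snd.
Qed.

Lemma piece_C1 a b s g i : piecewise_nice a b s g -> (i < size s)%N ->
  let c := node a b s i in let d := node a b s i.+1 in
  C1_on c d (xcoord g) (deriv_within `[c, d] (xcoord g)) /\
  C1_on c d (ycoord g) (deriv_within `[c, d] (ycoord g)).
Proof.
move=> [cg abs nice] ils /=; have [ac cd db] := node_bounds abs ils.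
have [nx ny _] := nice _ ils; have [cx cy] := continuous_coords cg.
have sub : `[node a b s i, node a b s i.+1]%classic `<=` `[a, b]%classic.
  move=> u /=; rewrite !in_itv/= => /andP[su ut].
  by rewrite (le_trans ac su) (le_trans ut db).
by split; apply: C1_withinP => //; [exact: continuous_subspaceW cx|exact: continuous_subspaceW cy].
Qed.

Section OnePiece.
Variables (c d : R) (cd : c < d).
Let I : set R := `[c, d].

(** The coordinates of the image of a curve by a similitude are of the form
[al * x + be * y + k]. *)
Lemma quotient_within_comb (x y : R -> R) (al be k t : R) : I t ->
  derivable_within I x t -> derivable_within I y t ->
  quotient_within I (fun u => al * x u + be * y u + k) t -->
  al * deriv_within I x t + be * deriv_within I y t.
Proof.
move=> It dx dy; have PF : ProperFilter (within I t^') by exact: within_dnbhs_proper.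
rewrite /quotient_within.
have -> : (fun u => (al * x u + be * y u + k - (al * x t + be * y t + k)) / (u - t)) =
    (fun u => al * ((x u - x t) / (u - t)) + be * ((y u - y t) / (u - t))).
  by apply/funext => u; rewrite !mulrA -mulrDl; congr (_ / _); ring.
by apply: cvgD; apply: cvgMr; [exact: dx|exact: dy].
Qed.

Lemma deriv_within_comb (x y : R -> R) (al be k t : R) : I t ->
  derivable_within I x t -> derivable_within I y t ->
  deriv_within I (fun u => al * x u + be * y u + k) t =
  al * deriv_within I x t + be * deriv_within I y t.
Proof.
move=> It dx dy; have PF : ProperFilter (within I t^') by exact: within_dnbhs_proper.
by apply: cvg_lim => //; exact: quotient_within_comb.
Qed.

Lemma C1_within_comb (x y : R -> R) (al be k : R) :
  C1_within I x -> C1_within I y ->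
  C1_within I (fun u => al * x u + be * y u + k).
Proof.
move=> [dx cx] [dy cy]; split.
  move=> t It; apply/cvg_ex; eexists; apply: quotient_within_comb => //.
    exact: dx.
  exact: dy.
apply: (@subspace_eq_continuous _ _ _
    (fun t => al * deriv_within I x t + be * deriv_within I y t)).
  move=> t; rewrite inE => It; symmetry; apply: deriv_within_comb => //; [exact: dx|exact: dy].
by apply: within_continuous_add; apply: within_continuous_mul => //;
  exact: within_continuous_cst.
Qed.

Variables (g : R -> R * R) (k : R) (T : R * R -> R * R).
Hypotheses (ng : nicely_rectifiable c d g) (k0 : 0 < k) (sT : similitude k T).

Lemma nicely_rectifiable_similitude : nicely_rectifiable c d (T \o g).
Proof.
have [nx ny nxy] := ng; have [al [be [e [v [e1 ab ->]]]]] := sT.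
have xE : xcoord (simil al be e v \o g) =
    (fun u => al * xcoord g u + (- (e * be)) * ycoord g u + v.1).
  by apply/funext => u; rewrite /xcoord/simil/= mulNr.
have yE : ycoord (simil al be e v \o g) =
    (fun u => be * xcoord g u + (e * al) * ycoord g u + v.2).
  by apply/funext => u; rewrite /ycoord/simil/=.
split; rewrite ?xE ?yE; try exact: C1_within_comb.
move=> t tcd; have It : I t by [].
have dx := nx.1 t It; have dy := ny.1 t It.
rewrite !deriv_within_comb//.
set x' := deriv_within _ _ _; set y' := deriv_within _ _ _ => -[h1 h2].
have k2 : al ^+ 2 + be ^+ 2 != 0 by rewrite ab sqrf_eq0 gt_eqF.
apply: (nxy t tcd); rewrite -/x' -/y'.
have X : (al ^+ 2 + be ^+ 2) * x' = 0.
  rewrite (_ : _ * x' = al * (al * x' + - (e * be) * y') + be * (be * x' + e * al * y')).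
    by rewrite h1 h2 !mulr0 addr0.
  by ring.
have Y : e * ((al ^+ 2 + be ^+ 2) * y') = 0.
  rewrite (_ : e * _ = al * (be * x' + e * al * y') - be * (al * x' + - (e * be) * y')).
    by rewrite h1 h2 !mulr0 subr0.
  by ring.
have e0 : e != 0 by apply: contra_eq_neq e1 => ->; rewrite expr0n eq_sym oner_eq0.
split; apply/eqP.
  by move/eqP : X; rewrite mulf_eq0 (negPf k2).
by move/eqP : Y; rewrite !mulf_eq0 (negPf e0) (negPf k2).
Qed.

(** The velocity is multiplied by the linear part of the similitude, an orthogonal
matrix times [k]. *)
Lemma speed_similitude t : I t -> speed I (T \o g) t = k * speed I g t.
Proof.
move=> It; have [nx ny _] := ng; have [al [be [e [v [e1 ab ->]]]]] := sT.
have xE : xcoord (simil al be e v \o g) =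
    (fun u => al * xcoord g u + (- (e * be)) * ycoord g u + v.1).
  by apply/funext => u; rewrite /xcoord/simil/= mulNr.
have yE : ycoord (simil al be e v \o g) =
    (fun u => be * xcoord g u + (e * al) * ycoord g u + v.2).
  by apply/funext => u; rewrite /ycoord/simil/=.
have dx := nx.1 t It; have dy := ny.1 t It.
rewrite /speed xE yE !deriv_within_comb//.
set x' := deriv_within _ _ _; set y' := deriv_within _ _ _.
rewrite -[k in RHS]gtr0_norm// -sqrtr_sqr -sqrtrM ?sqr_ge0// -ab.
congr Num.sqrt; rewrite !expr2 in e1 *; ring: e1.
Qed.

End OnePiece.

Lemma speed_continuous c d g : nicely_rectifiable c d g ->
  {within `[c, d], continuous (speed `[c, d] g)}.
Proof.
move=> [[_ cx] [_ cy] _]; apply: within_continuous_postcomp.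
  exact: sqrt_continuous.
apply: within_continuous_add.
  exact: (within_continuous_postcomp (@exprn_continuous _ 2)).
exact: (within_continuous_postcomp (@exprn_continuous _ 2)).
Qed.

Lemma parametrizes_similitude a b s g C k T : 0 < k -> similitude k T ->
  parametrizes a b s g C -> parametrizes a b s (T \o g) (T @` C).
Proof.
move=> k0 sT [ab [cg abs ng] [gab ig] CE].
have [U [sU TU UT]] := similitude_inv k0 sT; split => //.
- split => //.
    apply: (@within_continuous_comp (R * R)%type R (R * R)%type _ g T) => // p _.
    exact: similitude_continuous sT p.
  move=> i ils; have [_ cd _] := node_bounds abs ils.
  exact: (nicely_rectifiable_similitude cd (ng i ils) k0 sT).
- split; first by rewrite /= gab.
  by move=> x y xab yab /= /(can_inj TU); exact: ig.
- by rewrite CE image_comp.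
Qed.

Lemma curve_length_similitude a b s g C k T : 0 < k -> similitude k T ->
  parametrizes a b s g C ->
  curve_length a b s (T \o g) = k * curve_length a b s g.
Proof.
move=> k0 sT [ab [cg abs ng] _ _].
rewrite /curve_length mulr_sumr; apply: eq_big_nat => i /andP[_ ils].
have [_ cd _] := node_bounds abs ils; rewrite /arc_length -RintegralZl//.
  by apply: eq_Rintegral => t; rewrite inE => It; rewrite (speed_similitude cd (ng i ils) k0 sT).
apply: (within_continuous_integrable (speed_continuous (ng i ils))); exact: lexx.
Qed.

Lemma shape_similitude C k T : 0 < k -> similitude k T ->
  is_shape C -> is_shape (T @` C).
Proof.
move=> k0 sT [a [b [s [g Cg]]]]; exists a, b, s, (T \o g).
exact: (parametrizes_similitude k0 sT Cg).
Qed.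

Lemma shape_compact C : is_shape C -> compact C.
Proof.
move=> [a [b [s [g [ab [cg _ _] _ ->]]]]].
by apply: continuous_compact; [|exact: segment_compact].
Qed.

End Transport.

(** * Curve length as a total variation *)

Section Variation.
Variable R : realType.
Implicit Types (a b c d s t u : R) (g : R -> R * R).
Local Notation mu := (@lebesgue_measure R).

Definition hypot (x y : R) : R := Num.sqrt (x ^+ 2 + y ^+ 2).

Lemma hypot_ge0 x y : 0 <= hypot x y.
Proof. exact: sqrtr_ge0. Qed.

Lemma hypot_sqr x y : hypot x y ^+ 2 = x ^+ 2 + y ^+ 2.
Proof. by rewrite sqr_sqrtr// addr_ge0// sqr_ge0. Qed.

(** Cauchy-Schwarz in the plane: the difference of the squares is
[(u y - v x)^2]. *)
Lemma dot_le_hypot u v x y : u * x + v * y <= hypot u v * hypot x y.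
Proof.
rewrite -sqrtrM ?addr_ge0 ?sqr_ge0//.
rewrite (le_trans (ler_norm _))// -sqrtr_sqr ler_wsqrtr//.
by have := sqr_ge0 (u * y - v * x); nra.
Qed.

Lemma hypotD a b c d : hypot (a + c) (b + d) <= hypot a b + hypot c d.
Proof.
have [h0|h0] := eqVneq (hypot (a + c) (b + d)) 0.
  by rewrite h0 addr_ge0// hypot_ge0.
have hp : 0 < hypot (a + c) (b + d) by rewrite lt_def h0 hypot_ge0.
rewrite -(ler_pM2l hp) -expr2 hypot_sqr mulrDr.
have := dot_le_hypot (a + c) (b + d) a b; have := dot_le_hypot (a + c) (b + d) c d.
by lra.
Qed.

Lemma hypotZ k x y : 0 <= k -> hypot (k * x) (k * y) = k * hypot x y.
Proof.
move=> k0; rewrite /hypot !exprMn -mulrDr sqrtrM ?sqr_ge0// sqrtr_sqr.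
by rewrite ger0_norm.
Qed.

Lemma hypot_le_norm x y : hypot x y <= `|x| + `|y|.
Proof.
rewrite -(@ler_pXn2r _ 2) ?nnegrE ?hypot_ge0 ?addr_ge0// hypot_sqr.
rewrite -(real_normK (num_real x)) -(real_normK (num_real y)).
have xy0 : 0 <= `|x| * `|y| by rewrite mulr_ge0.
by nra.
Qed.

Definition edist (p q : R * R) : R := hypot (q.1 - p.1) (q.2 - p.2).

Lemma edistC p q : edist p q = edist q p.
Proof. by rewrite /edist /hypot -sqrrN opprB -[X in _ + X]sqrrN opprB. Qed.

Lemma edist_triangle p q r : edist p r <= edist p q + edist q r.
Proof.
rewrite /edist (_ : hypot (r.1 - p.1) _ = hypot ((q.1 - p.1) + (r.1 - q.1))
  ((q.2 - p.2) + (r.2 - q.2))) ?hypotD//.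
by congr hypot; ring.
Qed.

Lemma edistxx p : edist p p = 0.
Proof. by rewrite /edist /hypot !subrr expr0n addr0 sqrtr0. Qed.

Lemma edist_gt0 p q : p <> q -> 0 < edist p q.
Proof.
move=> pq; rewrite lt_def sqrtr_ge0 andbT; apply/eqP => h0; apply: pq.
have := hypot_sqr (q.1 - p.1) (q.2 - p.2); rewrite -/(edist p q) h0 expr0n/=.
move/esym/eqP; rewrite paddr_eq0 ?sqr_ge0// !sqrf_eq0 !subr_eq0.
by case: p q {h0} => x y [x' y'] /= /andP[/eqP-> /eqP->].
Qed.

Fixpoint polygon_length g a (s : seq R) : R :=
  if s is x :: s' then edist (g a) (g x) + polygon_length g x s' else 0.

Lemma polygon_length_cat g a (s1 s2 : seq R) : polygon_length g a (s1 ++ s2) =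
  polygon_length g a s1 + polygon_length g (last a s1) s2.
Proof. by elim: s1 a => [a|x s1 ih a] /=; rewrite ?add0r// ih addrA. Qed.

(** [L] is the total variation of [g] on the segment: inscribed polygons come
arbitrarily close to [L], and they never exceed it. The upper bound is stated
through a cumulative length [l], which bounds each chord by an additive
function of the parameter interval and so adapts to any family of chords. *)
Definition has_length g a b (L : R) : Prop :=
  (exists2 l : R -> R,
    forall s t, a <= s -> s <= t -> t <= b -> edist (g s) (g t) <= l t - l s &
    l b - l a = L) /\
  forall e, 0 < e -> exists2 s, itv_partition a b s & L <= polygon_length g a s + e.

Lemma has_length_refl g a : has_length g a a 0.
Proof.
split.
  exists (fun=> 0); last by rewrite subrr.
  move=> s t as_ st ta; have -> : s = a by apply/le_anti; rewrite (le_trans st ta).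
  have -> : t = a by apply/le_anti; rewrite ta (le_trans as_ st).
  by rewrite edistxx subrr.
move=> e e0; exists [::]; last by rewrite add0r ltW.
by split => /=.
Qed.

(** A chord that jumps over [m] is bounded by the two chords through [g m]. *)
Lemma has_length_glue g a m b L1 L2 : a <= m -> m <= b ->
  has_length g a m L1 -> has_length g m b L2 -> has_length g a b (L1 + L2).
Proof.
move=> am mb [[l1 l1P l1E] ap1] [[l2 l2P l2E] ap2]; split.
  exists (fun t => if t <= m then l1 t - l1 m else l2 t - l2 m); last first.
    rewrite am -l1E -l2E; case: ifPn => [bm|_]; last by ring.
    have -> : b = m by apply/le_anti; rewrite mb bm.
    by ring.
  move=> s t as_ st tb; case: (leP t m) => tm.
    by rewrite (le_trans st tm); have := l1P s t as_ st tm; lra.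
  case: (leP s m) => sm.
    2: by have := l2P s t (ltW sm) st tb; lra.
  have h1 := l1P s m as_ sm (lexx _); have h2 := l2P m t (lexx _) (ltW tm) tb.
  by have := edist_triangle (g s) (g m) (g t); lra.
move=> e e0; have e2 : 0 < e / 2 by rewrite divr_gt0.
have [s1 p1 h1] := ap1 _ e2; have [s2 p2 h2] := ap2 _ e2.
exists (s1 ++ s2); first exact: itv_partition_cat p1 p2.
by rewrite polygon_length_cat; have [_ /eqP->] := p1; lra.
Qed.

Lemma has_length_partition g a b (s : seq R) (F : R -> R -> R) :
  itv_partition a b s ->
  (forall i, (i < size s)%N -> has_length g (node a b s i) (node a b s i.+1)
     (F (node a b s i) (node a b s i.+1))) ->
  has_length g a b (\sum_(0 <= i < size s) F (node a b s i) (node a b s i.+1)).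
Proof.
elim: s a => [a /itv_partition_nil<- _|x s ih a abs H].
  by rewrite big_geq//; exact: has_length_refl.
have xb := itv_partition_cons abs.
rewrite /= big_nat_recl//; apply: (@has_length_glue _ _ x).
- by have [/= /andP[/ltW]] := abs.
- exact: itv_partition_le xb.
- exact: (H 0%N).
- by apply: ih => // i; exact: (H i.+1).
Qed.

(** The supremum of the [t] such that [P c t] holds is [d]: around this supremum
the local hypothesis extends [P c t] to its right. *)
Lemma cousin (P : R -> R -> Prop) c d : c <= d ->
  (forall s t u, c <= s -> s <= t -> t <= u -> u <= d ->
     P s t -> P t u -> P s u) ->
  (forall t, c <= t <= d -> exists2 dl, 0 < dl & forall s u,
     c <= s -> s <= t -> t <= u -> u <= d -> u - s < dl -> P s u) ->
  P c d.
Proof.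
move=> cd Ptr Ploc.
have Prefl t : c <= t <= d -> P t t.
  move=> /[dup] /andP[ct td] /Ploc[dl dl0]; apply=> //; by rewrite subrr.
pose A := [set t | c <= t <= d /\ P c t].
have Ac : A c by split; [rewrite lexx|apply: Prefl; rewrite lexx].
have hA : has_sup A.
  by split; [exists c|exists d => t [/andP[]]].
have cm : c <= sup A by apply: ub_le_sup => //; case: hA.
have md : sup A <= d by apply: sup_le_ub; [exists c|move=> t [/andP[]]].
have [dl dl0 dlP] := Ploc (sup A) ltac:(by rewrite cm md).
have dl2 : 0 < dl / 2 by rewrite divr_gt0.
have [t [/andP[ct td] Pt] mt] := sup_adherent dl2 hA.
have tm : t <= sup A by apply: ub_le_sup; [case: hA|split; rewrite ?ct].
have [md2|md2] := leP d (sup A + dl / 2).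
  apply: (Ptr c t d (lexx _) ct (le_trans tm md) (lexx _) Pt).
  by apply: dlP => //; lra.
have : A (sup A + dl / 2).
  split; first by apply/andP; split; lra.
  apply: (Ptr c t) => //; rewrite ?lexx//; try lra.
  by apply: dlP => //; lra.
by move=> /(ub_le_sup hA.2); lra.
Qed.

Section C1Piece.
Variables (c d : R) (x x' y y' : R -> R).
Hypotheses (cd : c <= d) (X : C1_on c d x x') (Y : C1_on c d y y').
Let sigma t := hypot (x' t) (y' t).

Let csigma : {within `[c, d], continuous sigma}.
Proof.
apply: within_continuous_postcomp; first exact: sqrt_continuous.
apply: within_continuous_add.
  exact: (within_continuous_postcomp (@exprn_continuous _ 2) (C1_cont' X)).
exact: (within_continuous_postcomp (@exprn_continuous _ 2) (C1_cont' Y)).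
Qed.

Let comb_continuous al be :
  {within `[c, d], continuous (fun r => al * x' r + be * y' r)}.
Proof.
apply: within_continuous_add; apply: within_continuous_mul.
- exact: within_continuous_cst.
- exact: (C1_cont' X).
- exact: within_continuous_cst.
- exact: (C1_cont' Y).
Qed.

(** The square of the length [H] of the chord is the integral of the scalar product
of the chord with the velocity, hence at most [H] times the integral of the
speed. *)
Lemma chord_le_integral s t : c <= s -> s <= t -> t <= d ->
  hypot (x t - x s) (y t - y s) <= \int[mu]_(r in `[s, t]) sigma r.
Proof.
move=> cs st td; set H := hypot _ _.
have [H0|H0] := eqVneq H 0.
  by rewrite H0; apply: Rintegral_ge0 => r _; exact: hypot_ge0.
have Hp : 0 < H by rewrite lt_def H0 hypot_ge0.
rewrite -(ler_pM2l Hp) -expr2 hypot_sqr.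
have xi := within_continuous_integrable (C1_cont' X) cs td.
have yi := within_continuous_integrable (C1_cont' Y) cs td.
have si := within_continuous_integrable csigma cs td.
set DX := x t - x s; set DY := y t - y s.
have -> : DX ^+ 2 + DY ^+ 2 =
    \int[mu]_(r in `[s, t]) (DX * x' r + DY * y' r).
  rewrite RintegralD//; last first.
  - apply: (within_continuous_integrable _ cs td).
    by apply: within_continuous_mul; [exact: within_continuous_cst|exact: C1_cont' Y].
  - apply: (within_continuous_integrable _ cs td).
    by apply: within_continuous_mul; [exact: within_continuous_cst|exact: C1_cont' X].
  by rewrite !RintegralZl// (FTC_C1_on X)// (FTC_C1_on Y).
rewrite -RintegralZl//; apply: le_Rintegral => //.
- by apply: (within_continuous_integrable _ cs td); exact: comb_continuous.
- apply: (within_continuous_integrable _ cs td).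
  by apply: within_continuous_mul => //; exact: within_continuous_cst.
- by move=> r _; exact: dot_le_hypot.
Qed.

Lemma integral_itv_bound (f : R -> R) k e s t : c <= s -> s <= t -> t <= d ->
  {within `[c, d], continuous f} -> (forall r, s <= r <= t -> `|f r - k| <= e) ->
  `|\int[mu]_(r in `[s, t]) f r - k * (t - s)| <= e * (t - s).
Proof.
move=> cs st td cf fk.
have fi := within_continuous_integrable cf cs td.
have ki (r : R) : mu.-integrable `[s, t] (EFin \o (fun=> r)).
  by apply: (within_continuous_integrable _ cs td); exact: within_continuous_cst.
have fk' r : s <= r <= t -> k - e <= f r <= k + e.
  by move=> /fk; rewrite ler_norml => /andP[? ?]; apply/andP; split; lra.
have lo : (k - e) * (t - s) <= \int[mu]_(r in `[s, t]) f r.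
  rewrite -Rintegral_itv_cst//; apply: le_Rintegral => // r.
  by rewrite /= in_itv/= => /fk'/andP[].
have hi : \int[mu]_(r in `[s, t]) f r <= (k + e) * (t - s).
  rewrite -Rintegral_itv_cst//; apply: le_Rintegral => // r.
  by rewrite /= in_itv/= => /fk'/andP[].
by rewrite ler_norml; apply/andP; split; lra.
Qed.

Lemma within_continuous_near (f : R -> R) t e : {within `[c, d], continuous f} ->
  c <= t <= d -> 0 < e ->
  exists2 dl, 0 < dl & forall r, c <= r <= d -> `|r - t| < dl -> `|f r - f t| <= e.
Proof.
move=> /subspace_continuousP/(_ t) cf tcd e0.
have /cf/cvgrPdist_le/(_ e e0) : `[c, d]%classic t by rewrite /= in_itv.
rewrite /prop_near1 /within/= => /nbhs_ballP[dl /= dl0 H]; exists dl => // r rcd rt.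
by rewrite distrC; apply: H; rewrite /= ?in_itv//= /ball/= distrC.
Qed.

(** Near [t] the velocity is almost constant, so chord and arc both have length
almost [`|g' t|] times the increment of the parameter. *)
Lemma chord_ge_integral_near e t : 0 < e -> c <= t <= d ->
  exists2 dl, 0 < dl & forall s u, c <= s -> s <= t -> t <= u -> u <= d ->
   u - s < dl ->
   \int[mu]_(r in `[s, u]) sigma r <= hypot (x u - x s) (y u - y s) + e * (u - s).
Proof.
move=> e0 tcd; have e4 : 0 < e / 4 by rewrite divr_gt0.
have [d1 d10 X1] := within_continuous_near (C1_cont' X) tcd e4.
have [d2 d20 Y1] := within_continuous_near (C1_cont' Y) tcd e4.
exists (Num.min d1 d2) => [|s u cs st tu ud]; first by rewrite lt_min d10.
rewrite lt_min => /andP[us1 us2].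
have su := le_trans st tu.
have rng r : s <= r <= u -> [/\ c <= r <= d, `|r - t| < d1 & `|r - t| < d2].
  move=> /andP[? ?]; split; first by apply/andP; split; lra.
    by rewrite ltr_norml; apply/andP; split; lra.
  by rewrite ltr_norml; apply/andP; split; lra.
have X2 r : s <= r <= u -> `|x' r - x' t| <= e / 4 by move=> /rng[*]; exact: X1.
have Y2 r : s <= r <= u -> `|y' r - y' t| <= e / 4 by move=> /rng[*]; exact: Y1.
have := integral_itv_bound cs su ud (C1_cont' X) X2; rewrite (FTC_C1_on X)// => IX.
have := integral_itv_bound cs su ud (C1_cont' Y) Y2; rewrite (FTC_C1_on Y)// => IY.
set DX := x u - x s in IX *; set DY := y u - y s in IY *.
have us0 : 0 <= u - s by rewrite subr_ge0.
have up : \int[mu]_(r in `[s, u]) sigma r <= (hypot (x' t) (y' t) + e / 2) * (u - s).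
  rewrite -Rintegral_itv_cst//; apply: le_Rintegral => //.
  - by apply: (within_continuous_integrable _ cs ud).
  - by apply: (within_continuous_integrable _ cs ud); exact: within_continuous_cst.
  - move=> r; rewrite /= in_itv/= => sru.
    have -> : sigma r = hypot (x' t + (x' r - x' t)) (y' t + (y' r - y' t)).
      by rewrite /sigma; congr hypot; ring.
    rewrite (le_trans (hypotD _ _ _ _))// lerD2l (le_trans (hypot_le_norm _ _))//.
    by have := X2 r sru; have := Y2 r sru; lra.
have lo : hypot (x' t) (y' t) * (u - s) <= hypot DX DY + e / 2 * (u - s).
  rewrite mulrC -hypotZ//.
  have -> : hypot ((u - s) * x' t) ((u - s) * y' t) =
      hypot (DX + ((u - s) * x' t - DX)) (DY + ((u - s) * y' t - DY)).
    by congr hypot; ring.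
  rewrite (le_trans (hypotD _ _ _ _))// lerD2l (le_trans (hypot_le_norm _ _))//.
  rewrite distrC (distrC _ DY) ![(u - s) * _]mulrC.
  by lra.
by lra.
Qed.

(** Chords are at most arcs by [chord_le_integral]; a partition with short enough
steps is provided by [cousin], as the error of [chord_ge_integral_near] is
proportional to the length of the step. *)
Lemma has_length_C1 (g : R -> R * R) :
  (forall t, g t = (x t, y t)) ->
  has_length g c d (\int[mu]_(t in `[c, d]) sigma t).
Proof.
move=> gE.
have si s t : c <= s -> t <= d -> mu.-integrable `[s, t] (EFin \o sigma).
  exact: within_continuous_integrable.
have edE s t : edist (g s) (g t) = hypot (x t - x s) (y t - y s).
  by rewrite /edist !gE.
split.
  exists (fun t => \int[mu]_(r in `[c, t]) sigma r); last first.
    by rewrite set_itv1 Rintegral_set1 subr0.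
  move=> s t cs st td; rewrite edE (le_trans (chord_le_integral cs st td))//.
  by rewrite (Rintegral_itv_split cs st (si _ _ (lexx _) td)) addrAC subrr add0r.
move=> e e0.
have [cd'|] := ltP c d; last first.
  move=> dc; have -> : d = c by apply/le_anti; rewrite dc cd.
  exists [::]; first by split => /=.
  by rewrite set_itv1 Rintegral_set1 add0r ltW.
(* An error eps per unit of parameter adds up to e over the segment. *)
pose eps := e / (d - c).
have eps0 : 0 < eps by rewrite divr_gt0// subr_gt0.
pose P s t := exists2 p, itv_partition s t p &
  \int[mu]_(r in `[s, t]) sigma r <= polygon_length g s p + eps * (t - s).
have [p pcd pP] : P c d; last first.
  by exists p => //; move: pP; rewrite /eps divfK// gt_eqF// subr_gt0.
apply: cousin => //.
  move=> s t u cs st tu ud [p1 pp1 H1] [p2 pp2 H2].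
  exists (p1 ++ p2); first exact: itv_partition_cat pp1 pp2.
  rewrite polygon_length_cat; have [_ /eqP->] := pp1.
  by rewrite (Rintegral_itv_split st tu (si _ _ cs ud)); lra.
move=> t tcd; have [dl dl0 H] := chord_ge_integral_near eps0 tcd.
exists dl => // s u cs st tu ud us.
have := H s u cs st tu ud us; rewrite -edE => Hsu.
have := le_trans st tu; rewrite le_eqVlt => /predU1P[su|su].
  exists [::]; first by rewrite su; split => /=.
  by rewrite -su set_itv1 Rintegral_set1 subrr mulr0 add0r.
exists [:: u]; first exact: itv_partition1.
by rewrite /= addr0.
Qed.

End C1Piece.

Lemma curve_has_length a b (s : seq R) g : piecewise_nice a b s g ->
  has_length g a b (curve_length a b s g).
Proof.
move=> pn; have [_ abs _] := pn.
apply: (has_length_partition (F := fun c d => arc_length c d g) abs) => i ils.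
have [_ /ltW cd _] := node_bounds abs ils.
have [X Y] := piece_C1 pn ils.
by apply: (has_length_C1 cd X Y) => t; rewrite /xcoord /ycoord; case: (g t).
Qed.

End Variation.

(** * Increments over disjoint arcs *)

Section Arcs.
Variable R : realType.
Implicit Types (a b r : R) (xs : seq R) (l : R -> R).

Lemma cell_dichotomy xs r j : sorted <%R xs -> r \in xs ->
  (j.+1 < size xs)%N -> r <= nth 0 xs j \/ nth 0 xs j.+1 <= r.
Proof.
move=> /(lt_sorted_leq_nth 0) mono rx jx; rewrite -(nth_index 0 rx).
have ix : (index r xs < size xs)%N by rewrite index_mem.
rewrite !mono ?inE//; last exact: ltnW.
by case: (leqP (index r xs) j) => [|h]; [left|right].
Qed.

(** The cells between [s] and [u] telescope: clamping the points of [xs] to the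
segment from [s] to [u] keeps the increments over these cells and kills the
others. *)
Lemma sum_cells xs l s u : sorted <%R xs -> s \in xs -> u \in xs -> s <= u ->
  \sum_(j < (size xs).-1)
    (if (s <= nth 0 xs j) && (nth 0 xs j.+1 <= u)
     then l (nth 0 xs j.+1) - l (nth 0 xs j) else 0) = l u - l s.
Proof.
move=> sx si ui su; pose cl r := Num.max s (Num.min r u).
have xpos : (0 < size xs)%N by case: (xs) si.
have mono := lt_sorted_leq_nth 0 sx.
have xle j r : (j < size xs)%N -> (index r xs <= j)%N -> r \in xs -> r <= nth 0 xs j.
  by move=> jx rj rx; rewrite -{1}(nth_index 0 rx) mono ?inE// index_mem.
have xge r : r \in xs -> nth 0 xs 0 <= r.
  by move=> rx; rewrite -(nth_index 0 rx) mono ?inE// index_mem.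
have lastE : cl (nth 0 xs (size xs).-1) = u.
  rewrite /cl min_r ?max_r// xle// ?prednK//.
  by rewrite -ltnS prednK// index_mem.
have firstE : cl (nth 0 xs 0) = s.
  by rewrite /cl max_l// ge_min xge.
rewrite -[in RHS]lastE -[in RHS]firstE.
rewrite -(telescope_sumr (fun j => l (cl (nth 0 xs j))))// big_mkord.
apply: eq_bigr => j _.
have jx : (j.+1 < size xs)%N by rewrite -ltn_predRL.
have xlt : nth 0 xs j < nth 0 xs j.+1.
  by rewrite (lt_sorted_ltn_nth 0 sx) ?inE// ltnW.
have [sj|sj] := cell_dichotomy sx si jx; have [uj|uj] := cell_dichotomy sx ui jx.
- rewrite [_ <= u]leNgt (le_lt_trans uj xlt) andbF /cl.
  by rewrite !min_r ?(le_trans uj (ltW xlt))// subrr.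
- rewrite sj uj/= /cl !min_l ?(le_trans (ltW xlt))// !max_r//.
  exact: le_trans sj (ltW xlt).
- have : s < s by rewrite (le_lt_trans su)// (le_lt_trans uj)// (lt_le_trans xlt).
  by rewrite ltxx.
- rewrite [s <= _]leNgt (lt_le_trans xlt sj)/= /cl.
  by rewrite !max_l ?subrr// ge_min ?sj// (le_trans (ltW xlt)).
Qed.

(** The arc of index [i] is the open interval from [s i] to [u i], or the rest of
the closed curve when [be i] is false. The endpoints of all the arcs cut the
segment into cells; each arc is a union of cells, and the midpoint of a cell
lies in at most one arc, so each increment of [l] is counted at most once. *)
Lemma sum_arcs_le n (s u : 'I_n -> R) (be : 'I_n -> bool) a b l :
  a <= b ->
  (forall r1 r2, a <= r1 -> r1 <= r2 -> r2 <= b -> l r1 <= l r2) ->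
  (forall i, [/\ a <= s i, s i <= u i & u i <= b]) ->
  (forall i j r, a < r < b ->
     (if be i then s i < r < u i else (r < s i) || (u i < r)) ->
     (if be j then s j < r < u j else (r < s j) || (u j < r)) -> i = j) ->
  \sum_(i < n) (if be i then l (u i) - l (s i)
                else (l b - l a) - (l (u i) - l (s i))) <= l b - l a.
Proof.
move=> ab lmono su disj.
pose pts := a :: b :: ([seq s i | i <- enum 'I_n] ++ [seq u i | i <- enum 'I_n]).
pose xs := sort <=%R (undup pts).
have sx : sorted <%R xs by rewrite sort_lt_sorted undup_uniq.
have memx r : (r \in xs) = (r \in pts) by rewrite mem_sort mem_undup.
have ax : a \in xs by rewrite memx inE eqxx.
have bx : b \in xs by rewrite memx !inE eqxx orbT.
have six i : s i \in xs by rewrite memx !inE mem_cat map_f ?mem_enum ?orbT.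
have uix i : u i \in xs by rewrite memx !inE mem_cat [_ \in map u _]map_f ?mem_enum ?orbT.
have xsab r : r \in xs -> a <= r <= b.
  rewrite memx !inE mem_cat => /or4P[/eqP->|/eqP->|/mapP[i _ ->]|/mapP[i _ ->]].
  - by rewrite lexx.
  - by rewrite ab lexx.
  - by have [? ? ?] := su i; rewrite (le_trans _ (_ : u i <= b))// andbT.
  - by have [? ? ?] := su i; rewrite (le_trans _ (_ : s i <= u i)).
pose x j := nth 0 xs j; pose m := (size xs).-1.
pose D j := l (x j.+1) - l (x j).
pose IN i j := (s i <= x j) && (x j.+1 <= u i).
have jx (j : 'I_m) : (j.+1 < size xs)%N by rewrite -ltn_predRL.
have xlt (j : 'I_m) : x j < x j.+1.
  by rewrite /x (lt_sorted_ltn_nth 0 sx) ?inE// ltnW.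
have xab (j : 'I_m) : a <= x j /\ x j.+1 <= b.
  have /andP[? _] := xsab _ (mem_nth 0 (ltnW (jx j))).
  by have /andP[_ ?] := xsab _ (mem_nth 0 (jx j)).
have D0 (j : 'I_m) : 0 <= D j.
  by have [? ?] := xab j; rewrite subr_ge0 lmono// ltW.
have tot : \sum_(j < m) D j = l b - l a.
  rewrite -(sum_cells l sx ax bx ab); apply: eq_bigr => j _.
  by have [-> ->] := xab j.
have -> : \sum_(i < n) (if be i then l (u i) - l (s i)
                else (l b - l a) - (l (u i) - l (s i))) =
    \sum_(i < n) \sum_(j < m) (if IN i j == be i then D j else 0).
  apply: eq_bigr => i _; have [_ sui _] := su i.
  rewrite -(sum_cells l sx (six i) (uix i) sui) -tot; case: (be i).
    by apply: eq_bigr => j _; rewrite /IN eqb_id.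
  rewrite -sumrB; apply: eq_bigr => j _; rewrite eqbF_neg -/(x j) -/(x j.+1) -/(IN i j).
  by case: (IN i j) => /=; rewrite ?subrr ?subr0.
rewrite exchange_big/= -tot; apply: ler_sum => j _.
pose mid := (x j + x j.+1) / 2.
have [h1 h2] : x j < mid /\ mid < x j.+1 by have := xlt j; rewrite /mid; split; lra.
have midab : a < mid < b.
  by have [? ?] := xab j; apply/andP; split; lra.
have mid_in i : IN i j == be i ->
    if be i then s i < mid < u i else (mid < s i) || (u i < mid).
  rewrite /IN; case: (be i); rewrite ?eqb_id ?eqbF_neg.
    by move=> /andP[? ?]; apply/andP; split; lra.
  have [sj|sj] := cell_dichotomy sx (six i) (jx j); last first.
    by move=> _; apply/orP; left; apply: lt_le_trans h2 sj.
  have [uj|uj] := cell_dichotomy sx (uix i) (jx j); last first.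
    by rewrite sj uj.
  by move=> _; apply/orP; right; exact: le_lt_trans uj h1.
have [i INi|none] := pickP (fun i => IN i j == be i); last first.
  by rewrite big1// => i _; rewrite none.
rewrite (bigD1 i)//= INi big1 ?addr0// => i' ii'; case: ifPn => // INi'.
by move: ii'; rewrite (disj i i' mid) ?eqxx//; exact: mid_in.
Qed.

End Arcs.

(** * The perimeter depends on the curve only *)

Section ClosedCurve.
Variable R : realType.
Implicit Types (K C : set (R * R)) (r t u v : R).

Section OneCurve.
Variables (a b : R) (g : R -> R * R).
Hypotheses (ab : a < b) (cg : {within `[a, b], continuous g}).
Hypothesis gcl : simple_closed a b g.

Lemma simple_closed_inj x w : a <= x < b -> a <= w <= b -> g x = g w ->
  x = w \/ (x = a /\ w = b).
Proof.
have [gab ginj] := gcl; move=> xab /andP[aw]; rewrite le_eqVlt.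
move=> /predU1P[->|wb] gxw; [right|left]; last first.
  by apply: ginj; rewrite ?in_itv//= aw.
by split=> //; apply: ginj; rewrite ?in_itv//= ?lexx// gxw gab.
Qed.

Lemma arc_closed u v : a <= u -> v <= b -> closed (g @` `[u, v]).
Proof.
move=> au vb; apply: compact_closed; first exact: norm_hausdorff.
apply: continuous_compact; last exact: segment_compact.
apply: continuous_subspaceW cg => r /=; rewrite !in_itv/= => /andP[ur rv].
by rewrite (le_trans au ur) (le_trans rv vb).
Qed.

(** The points [g u] and [g v] cut the curve into two closed arcs that meet only at
these two points, so off them the arcs are separated. *)
Lemma connected_sub_arc K u v : connected K -> K `<=` g @` `[a, b] ->
  a <= u -> u < v -> v < b -> ~ K (g u) -> ~ K (g v) ->
  K `<=` g @` `[u, v] \/ K `<=` g @` (`[a, u] `|` `[v, b]).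
Proof.
move=> cK KC au uv vb Ku Kv; have ub := lt_trans uv vb.
set A := g @` `[u, v]; set B := g @` (`[a, u] `|` `[v, b]).
have cA : closed A by apply: arc_closed => //; exact: ltW.
have cB : closed B.
  rewrite /B image_setU; apply: closedU; apply: arc_closed; rewrite ?lexx//.
    exact: ltW.
  by rewrite (le_trans au)// ltW.
have dis p : K p -> A p -> B p -> False.
  move=> Kp [r1 /=]; rewrite in_itv/= => /andP[ur1 r1v] r1p.
  move=> [r2 r2uv r2p].
  have r2ab : a <= r2 <= b.
    by case: r2uv; rewrite /= in_itv/= => /andP[? ?]; apply/andP; split; lra.
  have r1ab : a <= r1 < b by apply/andP; split; lra.
  have r1u : r1 != u by apply: contra_notN Ku => /eqP <-; rewrite r1p.
  have r1v' : r1 != v by apply: contra_notN Kv => /eqP <-; rewrite r1p.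
  have {r1u}ur1 : u < r1 by rewrite lt_def r1u.
  have {r1v'}r1v : r1 < v by rewrite lt_neqAle r1v'.
  have [r12|[? ?]] := simple_closed_inj r1ab r2ab (etrans r1p (esym r2p)).
    by case: r2uv; rewrite /= in_itv/= -r12 => /andP[? ?]; lra.
  lra.
have KAB : K `<=` A `|` B.
  move=> p /KC[r /=]; rewrite in_itv/= => /andP[ar rb] <-.
  have [ru|ur] := leP r u; first by right; exists r => //; left; rewrite /= in_itv/= ar.
  have [vr|rv] := leP v r; first by right; exists r => //; right; rewrite /= in_itv/= vr.
  by left; exists r => //; rewrite /= in_itv/= !ltW.
have sep : separated (K `&` A) (K `&` B).
  split; apply/seteqP; split=> // p.
    move=> [clp [Kp Bp]]; apply: (dis p) => //.
    by apply: cA; apply: closure_subset clp; exact: subIsetr.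
  move=> [[Kp Ap] clp]; apply: (dis p) => //.
  by apply: cB; apply: closure_subset clp; exact: subIsetr.
have KK : K `<=` (K `&` A) `|` (K `&` B) by move=> p Kp; case: (KAB p Kp); [left|right].
have [h|h] := connected_subset sep KK cK; [left|right] => p /h[] //.
Qed.

(** Otherwise [K] misses one point on each of the two arcs from [g s] to [g t], and
these two points separate [g s] from [g t] by [connected_sub_arc]. *)
Lemma connected_contains_arc K s t : connected K -> K `<=` g @` `[a, b] ->
  a <= s -> s <= t -> t < b -> K (g s) -> K (g t) ->
  (forall r, s < r < t -> K (g r)) \/
  (forall r, a <= r < b -> (r < s) || (t < r) -> K (g r)).
Proof.
move=> cK KC as_ st tb Ks Kt; apply: contrapT => /not_orP[].
move=> /existsNP[r1 /not_implyP[/andP[sr1 r1t] Kr1]].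
move=> /existsNP[r2 /not_implyP[/andP[ar2 r2b] /not_implyP[/orP r2st Kr2]]].
have sab : a <= s < b by apply/andP; split; lra.
have tab : a <= t < b by apply/andP; split; lra.
have inC x w : a <= x < b -> a <= w <= b -> g w = g x -> x = w \/ (x = a /\ w = b).
  by move=> xab wab gwx; exact: simple_closed_inj.
case: r2st => r2st.
  have [h|h] := connected_sub_arc cK KC ar2 (lt_trans r2st sr1) (lt_trans r1t tb) Kr2 Kr1.
    have [w /=] := h _ Kt; rewrite in_itv/= => /andP[? ?] gw.
    have wab : a <= w <= b by apply/andP; split; lra.
    by have [|[]] := inC _ _ tab wab gw; lra.
  have [w wuv] := h _ Ks.
  have wab : a <= w <= b.
    by case: wuv; rewrite /= in_itv/= => /andP[? ?]; apply/andP; split; lra.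
  move=> gw; have [sw|[? ?]] := inC _ _ sab wab gw; last by lra.
  by case: wuv; rewrite /= in_itv/= => /andP[? ?]; lra.
have [h|h] := connected_sub_arc cK KC (le_trans as_ (ltW sr1)) (lt_trans r1t r2st) r2b Kr1 Kr2.
  have [w /=] := h _ Ks; rewrite in_itv/= => /andP[? ?] gw.
  have wab : a <= w <= b by apply/andP; split; lra.
  by have [|[]] := inC _ _ sab wab gw; lra.
have [w wuv] := h _ Kt.
have wab : a <= w <= b.
  by case: wuv; rewrite /= in_itv/= => /andP[? ?]; apply/andP; split; lra.
move=> gw; have [sw|[? ?]] := inC _ _ tab wab gw; last by lra.
by case: wuv; rewrite /= in_itv/= => /andP[? ?]; lra.
Qed.

(** Each chord is at most the increment of the cumulative length over an arc
contained in [K i]; these arcs are disjoint, so [sum_arcs_le] applies. *)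
Lemma sum_chords_le n (K : 'I_n -> set (R * R)) (p q : 'I_n -> R * R) L :
  has_length g a b L ->
  (forall i, [/\ connected (K i), K i `<=` g @` `[a, b], K i (p i) & K i (q i)]) ->
  (forall i j x, K i x -> K j x -> i = j) ->
  \sum_(i < n) edist (p i) (q i) <= L.
Proof.
move=> [[l lP <-] _] KP Kdis; have [gab ginj] := gcl.
have lmono r1 r2 : a <= r1 -> r1 <= r2 -> r2 <= b -> l r1 <= l r2.
  by move=> h1 h2 h3; rewrite -subr_ge0 (le_trans _ (lP _ _ h1 h2 h3))// hypot_ge0.
have param x : (g @` `[a, b]) x -> exists2 r, a <= r < b & g r = x.
  move=> [r /=]; rewrite in_itv/= => /andP[ar]; rewrite le_eqVlt.
  move=> /predU1P[->|rb] <-; last by exists r; rewrite // ar.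
  by exists a; rewrite // lexx.
have ex i : exists suc : R * R * bool, [/\ a <= suc.1.1, suc.1.1 <= suc.1.2,
    suc.1.2 < b, edist (p i) (q i) = edist (g suc.1.1) (g suc.1.2) &
    forall r, a < r < b -> (if suc.2 then suc.1.1 < r < suc.1.2
      else (r < suc.1.1) || (suc.1.2 < r)) -> K i (g r)].
  have [cK KC Kp Kq] := KP i.
  have [s /andP[as_ sb] gs] := param _ (KC _ Kp).
  have [t /andP[at_ tb] gt] := param _ (KC _ Kq).
  have key s' t' : a <= s' -> s' <= t' -> t' < b -> K i (g s') -> K i (g t') ->
      exists be : bool, forall r, a < r < b -> (if be then s' < r < t'
        else (r < s') || (t' < r)) -> K i (g r).
    move=> as' st' tb' Ks' Kt'.
    have [h|h] := connected_contains_arc cK KC as' st' tb' Ks' Kt'.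
      by exists true => r _; exact: h.
    by exists false => r /andP[ar rb]; apply: h; rewrite ltW.
  have Ks : K i (g s) by rewrite gs.
  have Kt : K i (g t) by rewrite gt.
  have [st|ts] := leP s t.
    have [be beP] := key s t as_ st tb Ks Kt; exists (s, t, be).
    by split => //=; rewrite gs gt.
  have [be beP] := key t s at_ (ltW ts) sb Kt Ks; exists (t, s, be).
  by split => //=; [exact: ltW|rewrite gs gt edistC].
have {ex}[f fP] := choice ex.
pose s i := (f i).1.1; pose u i := (f i).1.2; pose be i := (f i).2.
apply: (@le_trans _ _ (\sum_(i < n) (if be i then l (u i) - l (s i)
                else (l b - l a) - (l (u i) - l (s i))))).
  apply: ler_sum => i _; have [as_ su ub -> _] := fP i; rewrite -/(s i) -/(u i).
  case: (be i); first by apply: lP => //; exact: ltW.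
  have h1 := lP a (s i) (lexx _) as_ (ltW (le_lt_trans su ub)).
  have h2 := lP (u i) b (le_trans as_ su) (ltW ub) (lexx _).
  have := edist_triangle (g (s i)) (g a) (g (u i)).
  have e1 : edist (g (u i)) (g b) = edist (g a) (g (u i)) by rewrite -gab edistC.
  by rewrite [edist (g (s i)) (g a)]edistC; lra.
apply: sum_arcs_le => //; first exact: ltW.
  by move=> i; have [? ? /ltW] := fP i.
move=> i j r rab ri rj; apply: (Kdis _ _ (g r)).
  by have [_ _ _ _] := fP i; apply.
by have [_ _ _ _] := fP j; apply.
Qed.

Lemma polygon_length_sum (s : seq R) a' : last a' s = b ->
  polygon_length g a' s =
  \sum_(i < size s) edist (g (node a' b s i)) (g (node a' b s i.+1)).
Proof.
elim: s a' => [a' _|x s ih a' lb]; first by rewrite big_ord0.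
by rewrite /= big_ord_recl /= ih.
Qed.

Lemma shrink_chord c d e : a <= c -> c < d -> d <= b -> 0 < e ->
  exists2 d', c <= d' < d & edist (g c) (g d) <= edist (g c) (g d') + e.
Proof.
move=> ac cd db e0.
have [cx cy] := continuous_coords cg.
have dab : a <= d <= b by apply/andP; split; lra.
have e2 : 0 < e / 2 by rewrite divr_gt0.
have [d1 d10 X] := within_continuous_near cx dab e2.
have [d2 d20 Y] := within_continuous_near cy dab e2.
(* Half of the minimum, to get strict inequalities. *)
pose m := Num.min (d - c) (Num.min d1 d2) / 2.
have [m0 m1 m2 m3] : [/\ 0 < m, m < d - c, m < d1 & m < d2].
  have mn : 0 < Num.min (d - c) (Num.min d1 d2) by rewrite !lt_min subr_gt0 cd d10.
  have : m < Num.min (d - c) (Num.min d1 d2) by rewrite /m; lra.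
  by rewrite !lt_min => /and3P[-> -> ->]; split => //; rewrite divr_gt0.
exists (d - m); first by apply/andP; split; lra.
rewrite (le_trans (edist_triangle _ (g (d - m)) _))// lerD2l.
rewrite /edist (le_trans (hypot_le_norm _ _))//.
have dm : a <= d - m <= b by apply/andP; split; lra.
have dmd : `|d - m - d| = m by rewrite addrAC subrr sub0r normrN gtr0_norm.
have := X (d - m) dm; have := Y (d - m) dm; rewrite dmd.
by move=> /(_ m3) + /(_ m2); rewrite /xcoord /ycoord !(distrC (_ (g (d - m)))); lra.
Qed.

(** Consecutive edges of an inscribed polygon share a vertex, so the arc of each
edge is shortened a little at its end; injectivity then makes the arcs disjoint. *)
Lemma disjoint_chords e L : 0 < e -> has_length g a b L ->
  exists n (K : 'I_n -> set (R * R)) (p q : 'I_n -> R * R),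
  [/\ forall i, [/\ connected (K i), K i `<=` g @` `[a, b], K i (p i) & K i (q i)],
      forall i j x, K i x -> K j x -> i = j &
      L <= \sum_(i < n) edist (p i) (q i) + e].
Proof.
move=> e0 [_ ap]; have e2 : 0 < e / 2 by rewrite divr_gt0.
have [s abs Ls] := ap _ e2.
have bnd i := node_bounds abs (i := i).
have s0 : (0 < size s)%N.
  by move: abs ab; case: (s) => // /itv_partition_nil ->; rewrite ltxx.
have n0 : 0 < (size s)%:R :> R by rewrite ltr0n.
have en : 0 < e / 2 / (size s)%:R by rewrite divr_gt0.
pose x i := node a b s i.
have /choice[y yP] (i : 'I_(size s)) : exists d', x i <= d' < x i.+1 /\
    edist (g (x i)) (g (x i.+1)) <= edist (g (x i)) (g d') + e / 2 / (size s)%:R.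
  have [? ? ?] := bnd i (ltn_ord i).
  have [d' ? ?] : exists2 d', x i <= d' < x i.+1 &
      edist (g (x i)) (g (x i.+1)) <= edist (g (x i)) (g d') + e / 2 / (size s)%:R.
    exact: shrink_chord.
  by exists d'.
have yb (i : 'I_(size s)) : [/\ a <= x i, x i <= y i, y i < x i.+1 & x i.+1 <= b].
  by have [? ? ?] := bnd i (ltn_ord i); have [/andP[? ?] _] := yP i.
have xmono i j : (i <= j)%N -> (j < size s)%N -> x i <= x j.
  by move=> ij js; exact: node_le abs ij (ltnW js).
exists (size s), (fun i : 'I_(size s) => g @` `[x i, y i]), (fun i => g (x i)), (fun i => g (y i)).
split.
- move=> i; have [ax xy yx xb] := yb i.
  have sub : `[x i, y i]%classic `<=` `[a, b]%classic.
    by move=> r /=; rewrite !in_itv/= => /andP[? ?]; apply/andP; split; lra.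
  split.
  + apply: connected_continuous_connected; first exact: segment_connected.
    exact: continuous_subspaceW cg.
  + by move=> _ [r /sub rab <-]; exists r.
  + by exists (x i) => //; rewrite /= in_itv/= lexx.
  + by exists (y i) => //; rewrite /= in_itv/= lexx andbT.
- move=> i j p [r1 + r1p] [r2 + r2p]; rewrite /= !in_itv/=.
  move=> /andP[xr1 ry1] /andP[xr2 ry2].
  have [axi xyi yxi xbi] := yb i; have [axj xyj yxj xbj] := yb j.
  have r12 : r1 = r2.
    have [_ ginj] := gcl.
    by apply: ginj; rewrite ?r1p ?r2p// in_itv/=; apply/andP; split; lra.
  apply: val_inj => /=; have [ij|ij|//] := ltngtP i j.
    by exfalso; have := xmono i.+1 j ij (ltn_ord j); lra.
  by exfalso; have := xmono j.+1 i ij (ltn_ord i); lra.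
- have [_ /eqP lb] := abs.
  rewrite (le_trans Ls)// polygon_length_sum//.
  have : \sum_(i < size s) edist (g (x i)) (g (x i.+1)) <=
      \sum_(i < size s) (edist (g (x i)) (g (y i)) + e / 2 / (size s)%:R).
    by apply: ler_sum => i _; have [_] := yP i.
  have ne : e / 2 / (size s)%:R *+ size s = e / 2.
    by rewrite -[LHS]mulr_natr divfK// gt_eqF.
  rewrite big_split/= sumr_const card_ord ne.
  by rewrite /x; lra.
Qed.

End OneCurve.

(** The disjoint chords are taken from one parametrization and measured in the
other one: the statement of [sum_chords_le] involves the curve only through
its image. *)
Lemma curve_length_le a b s g a' b' s' g' C :
  parametrizes a b s g C -> parametrizes a' b' s' g' C ->
  curve_length a b s g <= curve_length a' b' s' g'.
Proof.
move=> [ab pn gcl CE] [ab' pn' gcl' CE']; apply/ler_addgt0Pr => e e0.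
have [cg _ _] := pn; have [cg' _ _] := pn'.
have [n [K [p [q [KP Kdis H]]]]] :=
  disjoint_chords ab cg gcl e0 (curve_has_length pn).
rewrite (le_trans H)// lerD2r.
apply: (sum_chords_le ab' cg' gcl' (curve_has_length pn')) Kdis.
by move=> i; have [? ? ? ?] := KP i; split; rewrite // -CE' CE.
Qed.

Lemma perimeterE a b s g C : parametrizes a b s g C ->
  perimeter C = curve_length a b s g.
Proof.
move=> P; rewrite /perimeter; case: xgetP => [l _|none]; last first.
  by have := none (curve_length a b s g); case; exists a, b, s, g.
move=> [a' [b' [s' [g' [P' ->]]]]]; apply/le_anti/andP; split.
  exact: (curve_length_le P' P).
exact: (curve_length_le P P').
Qed.

Lemma perimeter_similitude C k T : 0 < k -> similitude k T -> is_shape C ->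
  perimeter (T @` C) = k * perimeter C.
Proof.
move=> k0 sT [a [b [s [g P]]]]; rewrite (perimeterE P).
rewrite (perimeterE (parametrizes_similitude k0 sT P)).
exact: (curve_length_similitude k0 sT P).
Qed.

Lemma perimeter_gt0 C : is_shape C -> 0 < perimeter C.
Proof.
move=> [a [b [s [g P]]]]; rewrite (perimeterE P).
have [ab pn [gab ginj] _] := P; have [[l lP <-] _] := curve_has_length pn.
pose m := (a + b) / 2.
have [am mb] : a < m /\ m < b by rewrite /m; split; lra.
have gm : g a <> g m.
  move=> /ginj; rewrite !in_itv/= lexx ab (ltW am) mb => /(_ isT isT).
  by move=> am'; move: am; rewrite -am' ltxx.
have := edist_gt0 gm; have := lP a m (lexx _) (ltW am) (ltW mb).
have : 0 <= edist (g m) (g b) by exact: hypot_ge0.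
by have := lP m b (ltW am) (ltW mb) (lexx _); lra.
Qed.

End ClosedCurve.

(** * The winding number of a closed curve *)

Section Winding.
Variable R : realType.
Local Notation mu := (@lebesgue_measure R).

(** The derivative of the angle under which a point at [(x, y)] with velocity
[(x', y')] is seen from [(u, v)]. *)
Definition angular_speed (u v x y x' y' : R) : R :=
  ((x - u) * y' - (y - v) * x') / ((x - u) ^+ 2 + (y - v) ^+ 2).

Section OneCurve.
Variables (a b : R) (s : seq R) (g : R -> R * R).
Hypotheses (pn : piecewise_nice a b s g) (gab : g a = g b).
Let x := xcoord g.
Let y := ycoord g.
Let c i := node a b s i.
Let x' i := deriv_within `[c i, c i.+1] x.
Let y' i := deriv_within `[c i, c i.+1] y.

(** The net increase of the angle, that is, [2 pi] times the winding number of
the curve around [q]. *)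
Definition winding (q : R * R) : R := \sum_(0 <= i < size s)
  \int[mu]_(t in `[c i, c i.+1]) angular_speed q.1 q.2 (x t) (y t) (x' i t) (y' i t).

Let abs : itv_partition a b s.
Proof. by case: pn. Qed.

(** The increments of the primitive over the pieces telescope. *)
Lemma sum_integral_exact (F : R -> R) (f : nat -> R -> R) : F a = F b ->
  (forall i, (i < size s)%N -> C1_on (c i) (c i.+1) F (f i)) ->
  \sum_(0 <= i < size s) \int[mu]_(t in `[c i, c i.+1]) f i t = 0.
Proof.
move=> Fab H; transitivity (\sum_(0 <= i < size s) (F (c i.+1) - F (c i))).
  apply: eq_big_nat => i /andP[_ ils]; have [_ /ltW cc _] := node_bounds abs ils.
  exact: (FTC_C1_on (H i ils) (lexx _) cc (lexx _)).
rewrite (telescope_sumr (fun i => F (c i)))// /c /node (itv_partition_nth_size _ abs)/=.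
by rewrite Fab subrr.
Qed.

Let piece_ab i t : (i < size s)%N -> c i <= t <= c i.+1 -> a <= t <= b.
Proof.
move=> ils /andP[ct td]; have [ac _ cb] := node_bounds abs ils.
by rewrite (le_trans ac ct) (le_trans td cb).
Qed.

Let avoids (q : R * R) := forall t, a <= t <= b -> g t <> q.

Lemma angular_speed_continuous q i : avoids q -> (i < size s)%N ->
  {within `[c i, c i.+1], continuous
    (fun t => angular_speed q.1 q.2 (x t) (y t) (x' i t) (y' i t))}.
Proof.
move=> avq ils; have [X Y] := piece_C1 pn ils.
have sub1 (f : R -> R) (k : R) : {within `[c i, c i.+1], continuous f} ->
    {within `[c i, c i.+1], continuous (fun t => f t - k)}.
  by move=> cf; apply: within_continuous_sub => //; exact: within_continuous_cst.
have sq (f : R -> R) : {within `[c i, c i.+1], continuous f} ->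
    {within `[c i, c i.+1], continuous (fun t => f t ^+ 2)}.
  exact: (within_continuous_postcomp (@exprn_continuous _ 2)).
apply: within_continuous_div.
- apply: within_continuous_sub; apply: within_continuous_mul.
  + by apply: sub1; exact: (C1_cont X).
  + exact: (C1_cont' Y).
  + by apply: sub1; exact: (C1_cont Y).
  + exact: (C1_cont' X).
- apply: within_continuous_add; apply: sq; apply: sub1.
    exact: (C1_cont X).
  exact: (C1_cont Y).
- move=> t /=; rewrite in_itv/= => tc; apply/negP.
  rewrite paddr_eq0 ?sqr_ge0// !sqrf_eq0 !subr_eq0 => /andP[/eqP xq /eqP yq].
  apply: (avq t (piece_ab ils tc)).
  by move: xq yq; rewrite /x /y /xcoord /ycoord; case: (g t) q {avq} => ? ? [? ?] /= -> ->.
Qed.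

(** As [q'] is close to [q] compared with the distance to the curve, the vectors
from [q] and [q'] to a point of the curve make an angle less than [pi / 2], so
their angle is a continuous function of the point, the arctangent of [N / D].
The difference of the two windings is the increment of this angle along the
closed curve, which is zero. *)
Lemma winding_locally_const q r q' : 0 < r ->
  (forall t, a <= t <= b -> r <= `|x t - q.1| \/ r <= `|y t - q.2|) ->
  `|q'.1 - q.1| < r / 2 -> `|q'.2 - q.2| < r / 2 ->
  winding q' = winding q.
Proof.
move=> r0 far h1 h2; apply/eqP; rewrite -subr_eq0 /winding -sumrB; apply/eqP.
set w1 := q'.1 - q.1 in h1 *; set w2 := q'.2 - q.2 in h2 *.
pose X t := x t - q.1; pose Y t := y t - q.2.
(* N / D is the tangent of the angle from z to z - w, where z = (X, Y). *)
pose N t := w1 * Y t + - w2 * X t.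
pose D t := X t * X t + Y t * Y t + (- w1 * X t + - w2 * Y t).
have Dpos t : a <= t <= b -> 0 < D t.
  move=> /far; rewrite -/(X t) -/(Y t) => far_t.
  have r2 : r ^+ 2 <= X t ^+ 2 + Y t ^+ 2.
    have sq z : r <= `|z| -> r ^+ 2 <= z ^+ 2.
      by move=> rz; rewrite -(real_normK (num_real z)) ler_pXn2r// nnegrE// ltW.
    by case: far_t => /sq h; rewrite (le_trans h)// ?lerDl ?lerDr sqr_ge0.
  have w1r : w1 ^+ 2 <= (r / 2) ^+ 2.
    by rewrite -(real_normK (num_real w1)) ler_pXn2r ?nnegrE ?divr_ge0// ltW.
  have w2r : w2 ^+ 2 <= (r / 2) ^+ 2.
    by rewrite -(real_normK (num_real w2)) ler_pXn2r ?nnegrE ?divr_ge0// ltW.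
  have := sqr_ge0 (w1 - X t); have := sqr_ge0 (w2 - Y t).
  have : 0 < r ^+ 2 by rewrite exprn_gt0.
  by move: r2 w1r w2r; rewrite /D !expr2; lra.
have avq : avoids q.
  move=> t /far + gq; rewrite /x /y /xcoord /ycoord gq !subrr normr0.
  by case; rewrite leNgt r0.
have avq' : avoids q'.
  move=> t /far + gq; rewrite /x /y /xcoord /ycoord gq.
  by case; [move: h1|move: h2]; rewrite /w1 /w2; lra.
transitivity (\sum_(0 <= i < size s) \int[mu]_(t in `[c i, c i.+1])
   (angular_speed q'.1 q'.2 (x t) (y t) (x' i t) (y' i t) -
    angular_speed q.1 q.2 (x t) (y t) (x' i t) (y' i t))).
  apply: eq_big_nat => i /andP[_ ils]; rewrite RintegralB//.
    exact: within_continuous_integrable (angular_speed_continuous avq' ils) (lexx _) (lexx _).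
  exact: within_continuous_integrable (angular_speed_continuous avq ils) (lexx _) (lexx _).
apply: (@sum_integral_exact (fun t => atan (N t / D t))).
  by rewrite /N /D /X /Y /x /y /xcoord /ycoord gab.
move=> i ils; have [X1 Y1] := piece_C1 pn ils; rewrite -/(c i) -/(c i.+1) in X1 Y1.
have XC : C1_on (c i) (c i.+1) X (x' i).
  apply: C1_on_eq (C1_on_add X1 (C1_on_cst _ _ (- q.1))) _ => t _.
  by rewrite addr0.
have YC : C1_on (c i) (c i.+1) Y (y' i).
  apply: C1_on_eq (C1_on_add Y1 (C1_on_cst _ _ (- q.2))) _ => t _.
  by rewrite addr0.
have cst := @C1_on_cst R (c i) (c i.+1).
have NC := C1_on_add (C1_on_mul (cst w1) YC) (C1_on_mul (cst (- w2)) XC).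
have DC := C1_on_add (C1_on_add (C1_on_mul XC XC) (C1_on_mul YC YC))
  (C1_on_add (C1_on_mul (cst (- w1)) XC) (C1_on_mul (cst (- w2)) YC)).
have D0 t : c i <= t <= c i.+1 -> D t != 0.
  by move=> /(piece_ab ils)/Dpos; exact: lt0r_neq0.
have FC := C1_on_atan (C1_on_div NC DC D0).
apply: C1_on_eq FC _ => t tc; have Dt := Dpos t (piece_ab ils tc).
rewrite /angular_speed.
have -> : x t - q'.1 = X t - w1 by rewrite /X /w1; ring.
have -> : y t - q'.2 = Y t - w2 by rewrite /Y /w2; ring.
rewrite -/(X t) -/(Y t).
rewrite /D in Dt *; move: (X t) (Y t) (x' i t) (y' i t) Dt => X2 Y2 dx dy Dt.
have z0 : X2 ^+ 2 + Y2 ^+ 2 != 0.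
  apply: contraTneq Dt => /eqP; rewrite paddr_eq0 ?sqr_ge0// !sqrf_eq0.
  by move=> /andP[/eqP-> /eqP->]; rewrite !mulr0 !addr0 ltxx.
have zw0 : (X2 - w1) ^+ 2 + (Y2 - w2) ^+ 2 != 0.
  apply: contraTneq Dt => /eqP; rewrite paddr_eq0 ?sqr_ge0// !sqrf_eq0 !subr_eq0.
  move=> /andP[/eqP-> /eqP->].
  by rewrite (_ : _ + _ = 0) ?ltxx//; ring.
have D1 := lt0r_neq0 Dt.
field.
by rewrite z0 zw0 D1 gt_eqF// ltr_pwDl ?sqr_ge0// exprn_gt0.
Qed.

(** A curve that stays on one side of a vertical or horizontal line through [q] is
seen from [q] under an angle with a continuous determination, the arctangent of
a slope. *)
Lemma winding_half_plane q :
  (forall t, a <= t <= b -> x t - q.1 != 0) \/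
  (forall t, a <= t <= b -> y t - q.2 != 0) -> winding q = 0.
Proof.
move=> H; pose X t := x t - q.1; pose Y t := y t - q.2.
have XYC i : (i < size s)%N -> C1_on (c i) (c i.+1) X (x' i) /\
    C1_on (c i) (c i.+1) Y (y' i).
  move=> ils; have [X1 Y1] := piece_C1 pn ils; split.
    apply: C1_on_eq (C1_on_add X1 (C1_on_cst _ _ (- q.1))) _ => t _.
    by rewrite addr0.
  apply: C1_on_eq (C1_on_add Y1 (C1_on_cst _ _ (- q.2))) _ => t _.
  by rewrite addr0.
case: H => H.
  apply: (@sum_integral_exact (fun t => atan (Y t / X t))).
    by rewrite /X /Y /x /y /xcoord /ycoord gab.
  move=> i ils; have [XC YC] := XYC i ils.
  have X0 t : c i <= t <= c i.+1 -> X t != 0 by move=> /(piece_ab ils)/H.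
  apply: C1_on_eq (C1_on_atan (C1_on_div YC XC X0)) _ => t /X0 Xt0.
  rewrite /angular_speed -/(X t) -/(Y t); field.
  by rewrite Xt0 andbT paddr_eq0 ?sqr_ge0// !sqrf_eq0 (negPf Xt0).
apply: (@sum_integral_exact (fun t => (-1) * atan (X t / Y t))).
  by rewrite /X /Y /x /y /xcoord /ycoord gab.
move=> i ils; have [XC YC] := XYC i ils.
have Y0 t : c i <= t <= c i.+1 -> Y t != 0 by move=> /(piece_ab ils)/H.
have := C1_on_mul (C1_on_cst (c i) (c i.+1) (-1)) (C1_on_atan (C1_on_div XC YC Y0)).
move=> CC; apply: C1_on_eq CC _ => t /Y0 Yt0.
rewrite mulr0 addr0 /angular_speed -/(X t) -/(Y t); field.
by rewrite Yt0 andbT paddr_eq0 ?sqr_ge0// !sqrf_eq0 (negPf Yt0) andbF.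
Qed.

Let C := g @` `[a, b].

Let compactC : compact C.
Proof.
by have [cg _ _] := pn; apply: continuous_compact; [|exact: segment_compact].
Qed.

Lemma winding_nbhs q : (~` C) q ->
  \forall q' \near q, (~` C) q' /\ winding q' = winding q.
Proof.
move=> Cq.
have oC : open (~` C).
  by apply: closed_openC; apply: compact_closed compactC; exact: norm_hausdorff.
have /nbhs_ballP[r /= r0 rC] : nbhs q (~` C) by exact: open_nbhs_nbhs.
have r2 : 0 < r / 2 by rewrite divr_gt0.
have far t : a <= t <= b -> r <= `|x t - q.1| \/ r <= `|y t - q.2|.
  move=> tab; apply/orP; rewrite !leNgt -negb_and; apply/negP => /andP[h1 h2].
  apply: (rC (g t)); last by exists t => //=; rewrite in_itv.
  by split; rewrite /ball/= distrC.
apply/nbhs_ballP; exists (r / 2) => // q' [q1 q2]; split.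
  have rr : r / 2 <= r by lra.
  by apply: rC; split; [exact: le_ball rr _ q1|exact: le_ball rr _ q2].
by apply: (winding_locally_const r0 far); rewrite distrC.
Qed.

(** The sets of points of the complement where the winding does and does not take
its value at [p] are both open. *)
Lemma winding_component p q : connected_component (~` C) p q ->
  winding q = winding p.
Proof.
move=> pq; set A := connected_component (~` C) p in pq.
have AC : A `<=` ~` C by exact: connected_component_sub.
pose U := [set z | (~` C) z /\ winding z = winding p].
pose V := [set z | (~` C) z /\ winding z <> winding p].
have oU : open U.
  rewrite openE => z [Cz wz]; apply: filterS (winding_nbhs Cz) => z' [Cz' wz'].
  by split; [|exact: etrans wz' wz].
have oV : open V.
  rewrite openE => z [Cz wz]; apply: filterS (winding_nbhs Cz) => z' [Cz' wz'].
  by split => // wz''; apply: wz; rewrite -wz'.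
have Cp : (~` C) p.
  by apply: contrapT => nCp; move: pq; rewrite /A connected_component_out.
have AU : A `&` U = A.
  apply: (@component_connected _ (~` C) p (A `&` U)).
  - by exists p; split; [exact: connected_component_refl|].
  - by exists U.
  - exists (~` V); first exact: open_closedC.
    rewrite -/A; apply/seteqP; split=> z [Az Uz]; split=> //.
      by move=> [_]; case: Uz.
    have Cz := AC _ Az; split => //; apply: contrapT => wz; exact: Uz.
have : (A `&` U) q by rewrite AU.
by case=> _ [].
Qed.

(** An unbounded component contains points outside a square that contains the
curve, from which the curve is seen in a half plane. *)
Lemma winding_unbounded p : (~` C) p ->
  ~ bounded_set (connected_component (~` C) p) -> winding p = 0.
Proof.
move=> Cp unb.
have /compact_bounded/bounded_setP[M CM] := compactC.
have [q [pq qM]] : exists q, connected_component (~` C) p q /\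
    (M < `|q.1| \/ M < `|q.2|).
  apply: contrapT => none; apply: unb; apply/bounded_setP; exists M => q pq.
  by split; rewrite leNgt; apply/negP => Mq; apply: none; exists q; split => //;
    [left|right].
rewrite -(winding_component pq); apply: winding_half_plane.
have inC t : a <= t <= b -> `|x t| <= M /\ `|y t| <= M.
  by move=> tab; apply: (CM (g t)); exists t => //=; rewrite in_itv.
case: qM => Mq; [left|right] => t /inC[h1 h2]; rewrite subr_eq0;
  by apply: contraTneq Mq => <-; rewrite -leNgt.
Qed.

End OneCurve.
End Winding.

(** * Jump of the winding number across the curve *)

Section AngularSpeedJump.
Variable R : realType.
Implicit Types (h r M x y dx dy tau : R).

(** In complex notation with [z = x + iy], this is the imaginary part of
[z' / (z - ih) - z' / (z + ih) = 2 i h z' / (z^2 + h^2)]. *)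
Lemma angular_speed_diffE h x y dx dy :
  x ^+ 2 + (y - h) ^+ 2 != 0 -> x ^+ 2 + (y + h) ^+ 2 != 0 ->
  angular_speed 0 h x y dx dy - angular_speed 0 (- h) x y dx dy =
  2 * h * (dx * (x ^+ 2 - y ^+ 2 + h ^+ 2) + 2 * x * y * dy) /
  ((x ^+ 2 + (y - h) ^+ 2) * (x ^+ 2 + (y + h) ^+ 2)).
Proof. by move=> h1 h2; rewrite /angular_speed !subr0 opprK; field; rewrite h1 h2. Qed.

(** Here [tau] is the parameter counted from a point where the curve passes through
the origin with velocity [(1, 0)]. For the straight line [x = tau], [y = 0],
the difference is [2 h / (tau^2 + h^2)]; within a cone of slope [1 / 4] about
this line, it stays nonnegative, and for [`|tau|] at most [h] it is still of the
order of [h^-1]. *)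
Lemma angular_speed_diff_near h tau x y dx dy : 0 < h ->
  `|x - tau| <= `|tau| / 4 -> `|y| <= `|tau| / 4 ->
  `|dx - 1| <= 1 / 4 -> `|dy| <= 1 / 4 ->
  [/\ x ^+ 2 + (y - h) ^+ 2 != 0, x ^+ 2 + (y + h) ^+ 2 != 0,
    0 <= angular_speed 0 h x y dx dy - angular_speed 0 (- h) x y dx dy &
    `|tau| <= h ->
    (20 * h)^-1 <= angular_speed 0 h x y dx dy - angular_speed 0 (- h) x y dx dy].
Proof.
move=> h0 xt yt dx1 dy1.
have h2 : 0 < h ^+ 2 by rewrite exprn_gt0.
pose T : R := `|tau|; rewrite -/T in xt yt *; have T0 : 0 <= T by exact: normr_ge0.
have x_lo : 3 / 4 * T <= `|x|.
  by have := lerB_dist tau x; rewrite distrC -/T; lra.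
have x_hi : `|x| <= 5 / 4 * T.
  by have := ler_normD (x - tau) tau; rewrite subrK -/T; lra.
have sq (u v : R) : 0 <= u -> u <= v -> u ^+ 2 <= v ^+ 2.
  by move=> u0 uv; rewrite ler_pXn2r// nnegrE// (le_trans u0).
have x2_lo : 9 / 16 * T ^+ 2 <= x ^+ 2.
  have := sq (3 / 4 * T) `|x| ltac:(lra) x_lo; rewrite real_normK ?num_real//.
  by rewrite exprMn; lra.
have x2_hi : x ^+ 2 <= 25 / 16 * T ^+ 2.
  have := sq _ _ (normr_ge0 x) x_hi; rewrite real_normK ?num_real//.
  by rewrite exprMn; lra.
have y2_hi : y ^+ 2 <= T ^+ 2 / 16.
  have := sq _ _ (normr_ge0 y) yt; rewrite real_normK ?num_real//.
  by rewrite exprMn exprVn; lra.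
have T2 : 0 <= T ^+ 2 by rewrite sqr_ge0.
have pos (e : R) : e ^+ 2 = h ^+ 2 -> 0 < x ^+ 2 + (y + e) ^+ 2.
  move=> eh; have := sqr_ge0 (y + e); have [T_0|Tn0] := eqVneq T 0.
    have y0 : y = 0 by apply/eqP; rewrite -normr_le0; move: yt; rewrite T_0; lra.
    by rewrite y0 add0r eh => _; rewrite ltr_wpDl// sqr_ge0.
  have : 0 < T ^+ 2 by rewrite lt_def sqrf_eq0 Tn0.
  by lra.
have p1 : 0 < x ^+ 2 + (y - h) ^+ 2 by apply: pos; rewrite sqrrN.
have p2 : 0 < x ^+ 2 + (y + h) ^+ 2 by exact: pos.
have num : (T ^+ 2 + h ^+ 2) / 5 <= dx * (x ^+ 2 - y ^+ 2 + h ^+ 2) + 2 * x * y * dy.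
  (* From |x| <= 5 T / 4, |y| <= T / 4 and |dy| <= 1 / 4. *)
  have cross : `|2 * x * y * dy| <= 5 / 32 * T ^+ 2.
    rewrite !normrM gtr0_norm//.
    have : `|x| * `|y| <= (5 / 4 * T) * (T / 4) by rewrite ler_pM.
    move=> /(fun H => ler_pM (mulr_ge0 (normr_ge0 _) (normr_ge0 _)) (normr_ge0 dy) H dy1).
    by rewrite expr2; lra.
  have main : 3 / 4 * (T ^+ 2 / 2 + h ^+ 2) <= dx * (x ^+ 2 - y ^+ 2 + h ^+ 2).
    by move: dx1; rewrite ler_norml => /andP[? ?]; apply: ler_pM; lra.
  by move: cross; rewrite ler_norml => /andP[? _]; lra.
have den : (x ^+ 2 + (y - h) ^+ 2) * (x ^+ 2 + (y + h) ^+ 2) <=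
    (2 * (T ^+ 2 + h ^+ 2)) * (2 * (T ^+ 2 + h ^+ 2)).
  have s1 := sqr_ge0 (y - h); have s2 := sqr_ge0 (y + h).
  have s12 : (y - h) ^+ 2 + (y + h) ^+ 2 = 2 * (y ^+ 2 + h ^+ 2) by ring.
  by apply: ler_pM; lra.
rewrite angular_speed_diffE ?gt_eqF//; split => //; rewrite ?gt_eqF//.
  by rewrite divr_ge0 ?mulr_ge0 ?ltW//; lra.
move=> Th; have Th2 : T ^+ 2 <= h ^+ 2 by exact: sq.
rewrite ler_pdivlMr ?mulr_gt0// mulrC ler_pdivrMr ?mulr_gt0//.
rewrite (le_trans den)//.
have : (T ^+ 2 + h ^+ 2) * (T ^+ 2 + h ^+ 2) <= 2 * h ^+ 2 * (T ^+ 2 + h ^+ 2).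
  by rewrite ler_wpM2r; lra.
have : h ^+ 2 * ((T ^+ 2 + h ^+ 2) / 5) <= h ^+ 2 *
    (dx * (x ^+ 2 - y ^+ 2 + h ^+ 2) + 2 * x * y * dy) by rewrite ler_wpM2l// ltW.
move: (dx * _ + _) => Z; rewrite [2 * h * Z * _](_ : _ = 40 * (h ^+ 2 * Z)); last by ring.
by lra.
Qed.

(** Away from the origin both speeds are smooth in the viewpoint, so they differ by
[O(h)] between [(0, h)] and [(0, - h)]. *)
Lemma angular_speed_diff_far r M : 0 < r -> exists2 K, 0 <= K & forall h x y dx dy,
  0 < h -> h <= r / 2 -> h <= 1 ->
  `|x| <= M -> `|y| <= M -> `|dx| <= M -> `|dy| <= M ->
  r <= `|x| \/ r <= `|y| ->
  [/\ x ^+ 2 + (y - h) ^+ 2 != 0, x ^+ 2 + (y + h) ^+ 2 != 0 &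
  - (h * K) <= angular_speed 0 h x y dx dy - angular_speed 0 (- h) x y dx dy].
Proof.
move=> r0; pose M' := `|M|; pose B := M' * (M' ^+ 2 + 1) + 2 * M' * M' * M'.
have M0 : 0 <= M' by exact: normr_ge0.
have B0 : 0 <= B.
  by rewrite addr_ge0 ?mulr_ge0// addr_ge0// exprn_ge0.
pose q := (r / 2) ^+ 2.
have q0 : 0 < q by rewrite exprn_gt0// divr_gt0.
exists (2 * B / q ^+ 2) => [|h x y dx dy h0 hr h1 xM yM dxM dyM far].
  by apply: divr_ge0; [exact: mulr_ge0|exact: sqr_ge0].
have leM z : `|z| <= M -> `|z| <= M' by move=> zM; exact: le_trans zM (ler_norm _).
move: xM yM dxM dyM => /leM xM /leM yM /leM dxM /leM dyM.
have sq (u : R) : r / 2 <= `|u| -> q <= u ^+ 2.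
  by move=> ru; rewrite -(real_normK (num_real u)) ler_pXn2r// nnegrE ?normr_ge0// divr_ge0// ltW.
have fac (e : R) : `|e| = h -> q <= x ^+ 2 + (y + e) ^+ 2.
  move=> eh; case: far => far.
    by rewrite (le_trans (sq x _)) ?lerDl ?sqr_ge0//; lra.
  rewrite (le_trans (sq (y + e) _)) ?lerDr ?sqr_ge0//.
  by have := lerB_normD y e; rewrite eh; lra.
have f1 : q <= x ^+ 2 + (y - h) ^+ 2 by apply: fac; rewrite normrN gtr0_norm.
have f2 : q <= x ^+ 2 + (y + h) ^+ 2 by apply: fac; rewrite gtr0_norm.
have p1 := lt_le_trans q0 f1; have p2 := lt_le_trans q0 f2.
rewrite angular_speed_diffE ?gt_eqF//; split; rewrite ?gt_eqF//.
have den : q ^+ 2 <= (x ^+ 2 + (y - h) ^+ 2) * (x ^+ 2 + (y + h) ^+ 2).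
  by rewrite expr2; apply: ler_pM => //; exact: ltW.
set num := dx * _ + _.
have numB : `|num| <= B.
  rewrite (le_trans (ler_normD _ _))// lerD// !normrM; last first.
    by rewrite gtr0_norm// !ler_pM ?mulr_ge0.
  apply: ler_pM => //.
  have x2 : x ^+ 2 <= M' ^+ 2 by rewrite -(real_normK (num_real x)) ler_pXn2r// nnegrE.
  have y2 : y ^+ 2 <= M' ^+ 2 by rewrite -(real_normK (num_real y)) ler_pXn2r// nnegrE.
  have hh : h ^+ 2 <= 1 by rewrite expr_le1// ltW.
  have := sqr_ge0 x; have := sqr_ge0 y; have := sqr_ge0 h.
  by rewrite ler_norml => *; apply/andP; split; lra.
have nrm : `|2 * h * num / ((x ^+ 2 + (y - h) ^+ 2) * (x ^+ 2 + (y + h) ^+ 2))|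
   <= h * (2 * B / q ^+ 2).
  rewrite (_ : h * (2 * B / q ^+ 2) = (2 * h * B) / q ^+ 2); last by ring.
  have h20 : 0 <= 2 * h by rewrite mulr_ge0// ltW.
  rewrite normrM normfV (ger0_norm (mulr_ge0 (ltW p1) (ltW p2))).
  rewrite normrM (ger0_norm h20).
  apply: ler_pM; first exact: mulr_ge0.
  - by rewrite invr_ge0 mulr_ge0// ltW.
  - by rewrite ler_wpM2l.
  - by rewrite lef_pV2// posrE ?mulr_gt0// exprn_gt0.
by move: nrm; rewrite ler_norml => /andP[].
Qed.

End AngularSpeedJump.

Section Separation.
Variable R : realType.
Local Notation mu := (@lebesgue_measure R).

Section Jump.
Variables (a b : R) (s : seq R) (g : R -> R * R).
Hypotheses (ab : a < b) (pn : piecewise_nice a b s g) (gcl : simple_closed a b g).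
Let x := xcoord g.
Let y := ycoord g.
Let c i := node a b s i.
Let x' i := deriv_within `[c i, c i.+1] x.
Let y' i := deriv_within `[c i, c i.+1] y.
Variables (j : nat) (t0 : R).
Hypotheses (js : (j < size s)%N) (ct0 : c j < t0) (t0c : t0 < c j.+1).
Hypotheses (x0 : x t0 = 0) (y0 : y t0 = 0) (x'1 : x' j t0 = 1) (y'0 : y' j t0 = 0).

Let abs : itv_partition a b s.
Proof. by case: pn. Qed.

Let cg : {within `[a, b], continuous g}.
Proof. by case: pn. Qed.

Let k h i t := angular_speed 0 h (x t) (y t) (x' i t) (y' i t)
             - angular_speed 0 (- h) (x t) (y t) (x' i t) (y' i t).

(** The velocity stays close to its value [(1, 0)] at [t0]; integrating it shows
that the curve stays in a cone around its tangent. *)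
Lemma tangent_cone : exists2 dl, [/\ 0 < dl, c j < t0 - dl & t0 + dl < c j.+1] &
  forall t, `|t - t0| <= dl -> [/\ `|x t - (t - t0)| <= `|t - t0| / 4,
    `|y t| <= `|t - t0| / 4, `|x' j t - 1| <= 1 / 4 & `|y' j t| <= 1 / 4].
Proof.
have [X Y] := piece_C1 pn js; rewrite -/(c j) -/(c j.+1) -/x -/y in X Y.
have q0 : 0 < 1 / 4 :> R by [].
have t0I : c j <= t0 <= c j.+1 by rewrite !ltW.
have [d1 d10 X1] := within_continuous_near (C1_cont' X) t0I q0.
have [d2 d20 Y1] := within_continuous_near (C1_cont' Y) t0I q0.
pose m := Num.min (Num.min d1 d2) (Num.min (t0 - c j) (c j.+1 - t0)).
have m0 : 0 < m by rewrite !lt_min d10 d20 !subr_gt0 ct0.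
have [m1 m2 m3 m4] : [/\ m / 2 < d1, m / 2 < d2, m / 2 < t0 - c j & m / 2 < c j.+1 - t0].
  have : m / 2 < m by lra.
  by rewrite {2}/m !lt_min => /andP[/andP[? ?] /andP[? ?]].
exists (m / 2); first by split; lra.
have X2 t : `|t - t0| <= m / 2 -> `|x' j t - 1| <= 1 / 4.
  move=> tm; rewrite -[X in _ - X]x'1; apply: X1; last exact: le_lt_trans tm m1.
  by move: tm; rewrite ler_norml => /andP[? ?]; apply/andP; split; lra.
have Y2 t : `|t - t0| <= m / 2 -> `|y' j t - 0| <= 1 / 4.
  move=> tm; rewrite -[X in _ - X]y'0; apply: Y1; last exact: le_lt_trans tm m2.
  by move: tm; rewrite ler_norml => /andP[? ?]; apply/andP; split; lra.
move=> t tm; have [h1 h2] : c j <= t /\ t <= c j.+1.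
  by move: tm; rewrite ler_norml => /andP[? ?]; split; lra.
split; [| |exact: X2|by rewrite -[y' j t]subr0; exact: Y2].
  have [tt0|t0t] := leP t t0.
    have bnd r : t <= r <= t0 -> `|x' j r - 1| <= 1 / 4.
      move=> /andP[? ?]; apply: X2; rewrite (le_trans _ tm)//.
      by rewrite !ler0_norm ?subr_le0//; lra.
    have := integral_itv_bound h1 tt0 (ltW t0c) (C1_cont' X) bnd.
    rewrite (FTC_C1_on X)// ?(ltW t0c)// x0 => H.
    rewrite [in leRHS]ler0_norm ?subr_le0//.
    by move: H; rewrite !ler_norml => /andP[? ?]; apply/andP; split; lra.
  have bnd r : t0 <= r <= t -> `|x' j r - 1| <= 1 / 4.
    move=> /andP[? ?]; apply: X2; rewrite (le_trans _ tm)//.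
    by rewrite !ger0_norm ?subr_ge0//; lra.
  have := integral_itv_bound (ltW ct0) (ltW t0t) h2 (C1_cont' X) bnd.
  rewrite (FTC_C1_on X (ltW ct0) (ltW t0t) h2) x0 => H.
  rewrite [in leRHS]gtr0_norm ?subr_gt0//.
  by move: H; rewrite !ler_norml => /andP[? ?]; apply/andP; split; lra.
have [tt0|t0t] := leP t t0.
  have bnd r : t <= r <= t0 -> `|y' j r - 0| <= 1 / 4.
    move=> /andP[? ?]; apply: Y2; rewrite (le_trans _ tm)//.
    by rewrite !ler0_norm ?subr_le0//; lra.
  have := integral_itv_bound h1 tt0 (ltW t0c) (C1_cont' Y) bnd.
  rewrite (FTC_C1_on Y)// ?(ltW t0c)// y0 => H.
  rewrite [in leRHS]ler0_norm ?subr_le0//.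
  by move: H; rewrite !ler_norml => /andP[? ?]; apply/andP; split; lra.
have bnd r : t0 <= r <= t -> `|y' j r - 0| <= 1 / 4.
  move=> /andP[? ?]; apply: Y2; rewrite (le_trans _ tm)//.
  by rewrite !ger0_norm ?subr_ge0//; lra.
have := integral_itv_bound (ltW ct0) (ltW t0t) h2 (C1_cont' Y) bnd.
rewrite (FTC_C1_on Y (ltW ct0) (ltW t0t) h2) y0 => H.
rewrite [in leRHS]gtr0_norm ?subr_gt0//.
by move: H; rewrite !ler_norml => /andP[? ?]; apply/andP; split; lra.
Qed.

Let at0 : a < t0.
Proof. by have [ac _ _] := node_bounds abs js; exact: le_lt_trans ac ct0. Qed.

Let t0b : t0 < b.
Proof. by have [_ _ cb] := node_bounds abs js; exact: lt_le_trans t0c cb. Qed.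

(** By injectivity the curve passes through the origin at [t0] only, and the norm
attains a positive minimum on each of the two remaining segments. *)
Lemma away_from_point (dl : R) : 0 < dl -> exists2 r, 0 < r &
  forall t, a <= t <= b -> dl <= `|t - t0| -> r <= `|x t| \/ r <= `|y t|.
Proof.
move=> dl0; have [cx cy] := continuous_coords cg.
have [at0' t0b'] := (at0, t0b).
pose f (t : R) : R := `|x t| + `|y t|.
have cf : {within `[a, b], continuous f}.
  by apply: within_continuous_add; apply: within_continuous_postcomp => //; exact: norm_continuous.
have f_gt0 t : a <= t <= b -> t != t0 -> 0 < f t.
  move=> tab tt0; rewrite lt_def addr_ge0// andbT; apply: contra_neq tt0.
  move=> /eqP; rewrite paddr_eq0// !normr_eq0 => /andP[/eqP xt /eqP yt].
  have gt : g t0 = g t.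
    move: x0 y0 xt yt; rewrite /x /y /xcoord /ycoord.
    by case: (g t0) (g t) => ? ? [? ?] /= -> -> -> ->.
  have t0ab : a <= t0 < b by rewrite (ltW at0).
  have [//|[t0a _]] := simple_closed_inj ab gcl t0ab tab gt.
  by move: at0; rewrite t0a ltxx.
have [m1 m10 M1] : exists2 m, 0 < m & forall t, a <= t <= t0 - dl -> m <= f t.
  have [le|lt] := leP a (t0 - dl); last by exists 1 => // t /andP[? ?]; lra.
  have sub : `[a, t0 - dl]%classic `<=` `[a, b]%classic.
    by move=> t /=; rewrite !in_itv/= => /andP[? ?]; apply/andP; split; lra.
  have [w] := EVT_min le (continuous_subspaceW sub cf).
  rewrite in_itv/= => /andP[? ?] H; exists (f w).
    by apply: f_gt0; [apply/andP; split; lra|rewrite lt_eqF//; lra].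
  by move=> t tI; apply: H; rewrite in_itv.
have [m2 m20 M2] : exists2 m, 0 < m & forall t, t0 + dl <= t <= b -> m <= f t.
  have [le|lt] := leP (t0 + dl) b; last by exists 1 => // t /andP[? ?]; lra.
  have sub : `[t0 + dl, b]%classic `<=` `[a, b]%classic.
    by move=> t /=; rewrite !in_itv/= => /andP[? ?]; apply/andP; split; lra.
  have [w] := EVT_min le (continuous_subspaceW sub cf).
  rewrite in_itv/= => /andP[? ?] H; exists (f w).
    by apply: f_gt0; [apply/andP; split; lra|rewrite gt_eqF//; lra].
  by move=> t tI; apply: H; rewrite in_itv.
exists (Num.min m1 m2 / 2); first by rewrite divr_gt0// lt_min m10.
move=> t /andP[at_ tb] far; have : Num.min m1 m2 <= f t.
  rewrite ge_min; apply/orP.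
  have [tt0|t0t] := leP t t0; [left|right].
    by apply: M1; move: far; rewrite ler0_norm ?subr_le0// => ?; apply/andP; split; lra.
  by apply: M2; move: far; rewrite gtr0_norm ?subr_gt0// => ?; apply/andP; split; lra.
move: (Num.min m1 m2) => m; rewrite /f => mf.
by have [h|h] := leP (m / 2) `|x t|; [left|right; lra].
Qed.

Lemma piece_bounded i : (i < size s)%N -> exists M, forall t, c i <= t <= c i.+1 ->
  [/\ `|x t| <= M, `|y t| <= M, `|x' i t| <= M & `|y' i t| <= M].
Proof.
move=> ils; have [X Y] := piece_C1 pn ils; rewrite -/(c i) -/(c i.+1) -/x -/y in X Y.
have [_ /ltW cc _] := node_bounds abs ils.
pose f (t : R) : R := (`|x t| + `|y t|) + (`|x' i t| + `|y' i t|).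
have nc (h : R -> R) : {within `[c i, c i.+1], continuous h} ->
    {within `[c i, c i.+1], continuous (fun t => `|h t|)}.
  by apply: within_continuous_postcomp; exact: norm_continuous.
have cf : {within `[c i, c i.+1], continuous f}.
  apply: within_continuous_add; apply: within_continuous_add; apply: nc.
  - exact: C1_cont X.
  - exact: C1_cont Y.
  - exact: C1_cont' X.
  - exact: C1_cont' Y.
have [w _ H] := EVT_max cc cf; exists (f w) => t tI.
have ft : (`|x t| + `|y t|) + (`|x' i t| + `|y' i t|) <= f w.
  by apply: H; rewrite in_itv.
move: (f w) ft => M ft.
have := (normr_ge0 (x t), normr_ge0 (y t), normr_ge0 (x' i t), normr_ge0 (y' i t)).
by move=> [[[? ?] ?] ?]; split; lra.
Qed.

(** By [angular_speed_diff_near] the part of the curve with parameter between [t0]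
and [t0 + h] contributes at least [h * (20 h)^-1 = 1 / 20] to the difference,
independently of [h], while the rest of the curve contributes at least
[- O(h)]. *)
Lemma winding_jump : exists2 h, 0 < h &
  [/\ (~` (g @` `[a, b])) (0, h), (~` (g @` `[a, b])) (0, - h) &
      winding a b s g (0, - h) < winding a b s g (0, h)].
Proof.
have [dl [dl0 cdl dlc] near_t] := tangent_cone.
have [r r0 far] := away_from_point dl0.
have /choice[K KP] (i : nat) : exists Ki : R, (i < size s)%N -> 0 <= Ki /\
    forall h, 0 < h -> h <= r / 2 -> h <= 1 -> forall t, c i <= t <= c i.+1 ->
      - (h * Ki) <= k h i t.
  have [ils|] := boolP (i < size s)%N; last by exists 0.
  have [M Mi] := piece_bounded ils.
  have [Ki Ki0 H] := angular_speed_diff_far M r0; exists Ki => _; split => // h h0 hr h1 t tI.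
  have [xM yM x'M y'M] := Mi t tI.
  have [tdl|tdl] := leP `|t - t0| dl.
    have [ij|ij] := eqVneq i j.
      have [xt yt dx dy] := near_t t tdl; rewrite -ij in dx dy.
      have [_ _ + _] := angular_speed_diff_near h0 xt yt dx dy.
      by apply: le_trans; rewrite oppr_le0 mulr_ge0// ltW.
    move: tI => /andP[ct tc]; move: tdl; rewrite ler_norml => /andP[? ?].
    have [lt|lt|/eqP] := ltngtP i j; last by rewrite (negPf ij).
      by have := node_le abs lt (ltnW js); rewrite -/(c _) -/(c _); lra.
    by have := node_le abs lt (ltnW ils); rewrite -/(c _) -/(c _); lra.
  have tab : a <= t <= b.
    have [ac _ cb] := node_bounds abs ils; move: tI => /andP[ct tc].
    by rewrite (le_trans ac ct) (le_trans tc cb).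
  by have [] := H h _ _ _ _ h0 hr h1 xM yM x'M y'M (far t tab (ltW tdl)).
(* The far part of the curve contributes at least - h * Kt. *)
pose Kt := \sum_(0 <= i < size s) K i * (c i.+1 - c i).
have Kt0 : 0 <= Kt.
  rewrite /Kt big_nat; apply: sumr_ge0 => i /andP[_ ils].
  have [Ki _] := KP i ils; have [_ /ltW cc _] := node_bounds abs ils.
  by rewrite mulr_ge0// subr_ge0.
pose h := Num.min (Num.min (r / 2) 1) (Num.min dl (40 * (Kt + 1))^-1).
have Kt1 : 0 < 40 * (Kt + 1) by rewrite mulr_gt0// ltr_wpDl.
have h0 : 0 < h by rewrite !lt_min dl0 invr_gt0 Kt1 divr_gt0// ltr01.
have [hr h1 hdl hK] : [/\ h <= r / 2, h <= 1, h <= dl & h <= (40 * (Kt + 1))^-1].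
  by have := lexx h; rewrite {2}/h !le_min => /andP[/andP[? ?] /andP[? ?]].
have avoid (e : R) : `|e| = h -> forall t, a <= t <= b -> g t <> (0, e).
  move=> eh t tab gt.
  have [xt yt] : x t = 0 /\ y t = e by rewrite /x /y /xcoord /ycoord gt.
  have [tdl|tdl] := leP `|t - t0| dl.
    have [+ + _ _] := near_t t tdl; rewrite xt yt sub0r normrN eh.
    by move: (normr_ge0 (t - t0)); lra.
  have := far t tab (ltW tdl); rewrite xt yt eh normr0.
  by case; lra.
have av1 := avoid h (gtr0_norm h0).
have av2 : forall t, a <= t <= b -> g t <> (0, - h).
  by apply: avoid; rewrite normrN gtr0_norm.
exists h => //; split.
- by move=> [t]; rewrite /= in_itv/= => /av1.
- by move=> [t]; rewrite /= in_itv/= => /av2.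
rewrite -subr_gt0 /winding -sumrB -/c.
have ki i u v : (i < size s)%N -> c i <= u -> v <= c i.+1 ->
    mu.-integrable `[u, v] (EFin \o k h i).
  move=> ils cu vc; apply: (within_continuous_integrable _ cu vc).
  apply: within_continuous_sub.
    exact: (angular_speed_continuous pn (q := (0, h)) av1 ils).
  exact: (angular_speed_continuous pn (q := (0, - h)) av2 ils).
have lower i u v : (i < size s)%N -> c i <= u -> u <= v -> v <= c i.+1 ->
    - (h * K i) * (v - u) <= \int[mu]_(t in `[u, v]) k h i t.
  move=> ils cu uv vc; rewrite -Rintegral_itv_cst//; apply: le_Rintegral => //.
  - apply: (within_continuous_integrable (c := u) (d := v)) => //.
    exact: within_continuous_cst.
  - exact: ki.
  - move=> t; rewrite /= in_itv/= => /andP[ut tv]; have [_ H] := KP i ils.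
    by apply: H => //; rewrite (le_trans cu ut) (le_trans tv vc).
apply: (@lt_le_trans _ _ (\sum_(0 <= i < size s)
    ((if i == j then 1 / 20 else 0) - h * (K i * (c i.+1 - c i))))).
  rewrite sumrB -mulr_sumr -/Kt -big_mkcond big_nat1_eq js/=.
  have : h * (40 * (Kt + 1)) <= 1.
    by rewrite -ler_pdivlMr// mul1r.
  by lra.
rewrite !big_nat; apply: ler_sum => i /andP[_ ils].
have [_ /ltW cc _] := node_bounds abs ils; rewrite -/(c i) -/(c i.+1) in cc.
rewrite -RintegralB//=; last 2 first.
- apply: within_continuous_integrable (lexx _) (lexx _).
  exact: (angular_speed_continuous pn (q := (0, h)) av1 ils).
- apply: within_continuous_integrable (lexx _) (lexx _).
  exact: (angular_speed_continuous pn (q := (0, - h)) av2 ils).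
rewrite -[X in _ <= X]/(\int[mu]_(t in `[c i, c i.+1]) k h i t).
have [ij|ij] := eqVneq i j; last first.
  by have := lower i _ _ ils (lexx _) cc (lexx _); lra.
have l1 := lower i (c i) t0 ils (lexx _).
have l2 := lower i (t0 + h) (c i.+1) ils.
rewrite (@Rintegral_itv_split _ _ _ t0); last 3 first.
- by rewrite ij ltW.
- by rewrite ij ltW.
- exact: ki.
rewrite (@Rintegral_itv_split _ _ t0 (t0 + h)); last 3 first.
- by rewrite lerDl ltW.
- by rewrite ij; lra.
- by apply: ki => //; rewrite ij ltW.
have mid : 1 / 20 <= \int[mu]_(t in `[t0, t0 + h]) k h i t.
  have -> : 1 / 20 = (20 * h)^-1 * (t0 + h - t0) :> R by field; rewrite gt_eqF.
  rewrite -(@Rintegral_itv_cst R (20 * h)^-1 t0 (t0 + h)); last by rewrite lerDl ltW.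
  apply: le_Rintegral => //.
  - apply: (within_continuous_integrable (c := t0) (d := t0 + h)) => //.
    exact: within_continuous_cst.
  - by apply: ki; rewrite // ij; lra.
  - move=> t; rewrite /= in_itv/= => /andP[t0t th].
    have tt : `|t - t0| <= h by rewrite ger0_norm ?subr_ge0//; lra.
    have [xt yt dx dy] := near_t t (le_trans tt hdl); rewrite -ij in dx dy.
    by have [_ _ _] := angular_speed_diff_near h0 xt yt dx dy; apply.
have Ki0 : 0 <= h * K i by rewrite mulr_ge0 ?(ltW h0)//; case: (KP i ils).
have := l1 ltac:(by rewrite ij ltW) ltac:(by rewrite ij ltW).
have := l2 ltac:(rewrite ij; lra) ltac:(rewrite ij; lra) (lexx _).
have : 0 <= h * K i * h by rewrite mulr_ge0// ltW.
by lra.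
Qed.

End Jump.
End Separation.

(** * Areas and perimeters of similar shapes *)

Section SimilarShapes.
Variable R : realType.

(** A similitude normalizes the curve so that, in the middle of its first piece, it
passes through the origin with velocity [(1, 0)]. Then [winding_jump] gives two
points with distinct windings, which do not both lie in unbounded components. *)
Lemma shape_inside (C : set (R * R)) : is_shape C ->
  exists p, (~` C) p /\ bounded_set (connected_component (~` C) p).
Proof.
move=> [a [b [s [g P]]]]; have [ab [cg abs ng] gcl CE] := P.
have s0 : (0 < size s)%N.
  by move: abs ab; case: (s) => // /itv_partition_nil ->; rewrite ltxx.
have [_ cd _] := node_bounds abs s0; have nice := ng _ s0.
set c := node a b s 0 in cd nice *; set d := node a b s 1 in cd nice *.
pose t0 := (c + d) / 2.
have [ct0 t0d] : c < t0 /\ t0 < d by rewrite /t0; split; lra.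
have t0I : `[c, d]%classic t0 by rewrite /= in_itv/= !ltW.
have [nx ny nxy] := nice.
pose al0 := deriv_within `[c, d] (xcoord g) t0.
pose be0 := deriv_within `[c, d] (ycoord g) t0.
(* The linear part of T is the division by the velocity al0 + i be0. *)
pose n2 := al0 ^+ 2 + be0 ^+ 2.
have n20 : n2 != 0.
  apply/negP; rewrite paddr_eq0 ?sqr_ge0// !sqrf_eq0 => /andP[/eqP h1 /eqP h2].
  by apply: (nxy t0).
pose al := al0 / n2; pose be := - be0 / n2.
pose v : R * R := (- (al * (g t0).1 - 1 * be * (g t0).2),
                   - (be * (g t0).1 + 1 * al * (g t0).2)).
pose T := simil al be 1 v.
have ab2 : al ^+ 2 + be ^+ 2 = n2^-1.
  by rewrite /al /be !exprMn sqrrN -mulrDl -/n2 exprVn; field.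
have ab2_gt0 : 0 < al ^+ 2 + be ^+ 2.
  by rewrite ab2 invr_gt0 lt_def n20 addr_ge0// sqr_ge0.
pose k := Num.sqrt (al ^+ 2 + be ^+ 2).
have k0 : 0 < k by rewrite sqrtr_gt0.
have sT : similitude k T.
  by exists al, be, 1, v; rewrite expr1n sqr_sqrtr// ltW.
have PT := parametrizes_similitude k0 sT P.
have [_ pnT gclT CTE] := PT.
have xE : xcoord (T \o g) =
    (fun u => al * xcoord g u + (- (1 * be)) * ycoord g u + v.1).
  by apply/funext => u; rewrite /xcoord/T/simil/= mulNr.
have yE : ycoord (T \o g) =
    (fun u => be * xcoord g u + (1 * al) * ycoord g u + v.2).
  by apply/funext => u; rewrite /ycoord/T/simil/=.
have dx := nx.1 t0 t0I; have dy := ny.1 t0 t0I.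
have [h h0 [Ch Ch' wh]] : exists2 h, 0 < h &
  [/\ (~` ((T \o g) @` `[a, b])) (0, h), (~` ((T \o g) @` `[a, b])) (0, - h) &
      winding a b s (T \o g) (0, - h) < winding a b s (T \o g) (0, h)].
  apply: (@winding_jump R a b s (T \o g) ab pnT gclT 0%N t0 s0 ct0 t0d).
  - by rewrite /xcoord /T /simil /v/=; ring.
  - by rewrite /ycoord /T /simil /v/=; ring.
  - rewrite -/c -/d xE deriv_within_comb// -/al0 -/be0 /al /be.
    rewrite /n2 in n20 *; field; exact: n20.
  - rewrite -/c -/d yE deriv_within_comb// -/al0 -/be0 /al /be.
    rewrite /n2 in n20 *; field; exact: n20.
have [p [Cp bp]] : exists p, (~` (T @` C)) p /\
    bounded_set (connected_component (~` (T @` C)) p).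
  have gab : (T \o g) a = (T \o g) b by case: gclT.
  apply: contrapT => none; move: wh; rewrite -CTE in Ch Ch'.
  have unb q : (~` (T @` C)) q -> winding a b s (T \o g) q = 0.
    move=> Cq; apply: (winding_unbounded pnT gab); rewrite -CTE//.
    by move=> bq; apply: none; exists q.
  by rewrite (unb _ Ch) (unb _ Ch') ltxx.
have : region (T @` C) p by right.
rewrite (region_image _ k0 sT) => -[q [Cq|[Cq bq]] qp]; last by exists q.
by exfalso; apply: Cp; exists q.
Qed.

Lemma area_shape_gt0 (C : set (R * R)) : is_shape C -> 0 < area C.
Proof.
move=> sC; have [p [Cp bp]] := shape_inside sC.
exact: area_gt0 (shape_compact sC) Cp bp.
Qed.

Lemma semiperimeter_gt0 (C : set (R * R)) : is_shape C -> 0 < semiperimeter C.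
Proof. by move=> sC; rewrite divr_gt0// perimeter_gt0. Qed.

Lemma area_similitude (C : set (R * R)) k T : 0 < k -> similitude k T ->
  is_shape C -> area (T @` C) = k ^+ 2 * area C.
Proof. by move=> k0 sT /shape_compact; exact: area_image. Qed.

Lemma semiperimeter_similitude (C : set (R * R)) k T : 0 < k -> similitude k T ->
  is_shape C -> semiperimeter (T @` C) = k * semiperimeter C.
Proof.
by move=> k0 sT sC; rewrite /semiperimeter (perimeter_similitude k0 sT sC) mulrA.
Qed.

(** Similitudes of the same ratio differ by a similitude of ratio [1]. *)
Lemma similitude_congruent (C : set (R * R)) k T U :
  0 < k -> similitude k T -> similitude k U -> congruent (T @` C) (U @` C).
Proof.
move=> k0 sT sU; have [V [sV TV VT]] := similitude_inv k0 sT.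
apply/congruentP; exists (U \o V).
  by rewrite -(@mulfV _ k) ?gt_eqF//; exact: similitude_comp.
rewrite image_comp; congr (_ @` C); apply/funext => p /=.
by rewrite TV.
Qed.

(** Only the values at positive parameters are prescribed, but these determine the
derivative at [l]. *)
Lemma is_derive_area (F : R -> set (R * R)) (m l : R) : 0 < l ->
  (forall t, 0 < t -> area (F t) = m * t ^+ 2) ->
  is_derive l 1 (fun t => area (F t)) (2 * m * l).
Proof.
move=> l0 H; apply: (@near_eq_is_derive _ _ _ (fun t : R => m * t ^+ 2)).
  near=> t; rewrite H//; near: t; exact: lt_nbhsr.
apply: is_derive_eq; rewrite /GRing.scale/=; ring.
Unshelve. all: by end_near. Qed.

End SimilarShapes.

(** * The calculus-friendly indexing *)

Unset Implicit Arguments.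
Set Strict Implicit.
Set Printing Implicit Defensive.

Theorem theorem3p1 (R : realType) (C : set (R * R)) (hC : is_shape C) :
  let upsilon : R := semiperimeter C / area C in
  let D : R -> set (R * R) :=
    fun lambda => standard_indexing C (lambda * upsilon) in
  [/\ [/\ calculus_friendly D,
          members D = members (standard_indexing C),
          D 1 = standard_indexing C upsilon,
          unique (fun X => members D X /\ area X = semiperimeter X) (D 1) &
          forall lambda : R, 0 < lambda ->
            D lambda = standard_indexing (D 1) lambda],
      (forall B : R -> set (R * R),
         calculus_friendly B ->
         (exists2 kappa : R, 0 < kappa & congruent (B kappa) C) ->
         forall lambda : R, 0 < lambda ->
           congruent (B lambda) (D lambda) /\
           lambda = area (B lambda) / semiperimeter (B lambda)) &
      (forall U : set (R * R),
         is_shape U -> similar_shapes C U -> area U = semiperimeter U ->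
         congruent U (D 1))].
Proof.
move=> u D; have A0 := area_shape_gt0 hC; have S0 := semiperimeter_gt0 hC.
have u0 : 0 < u by rewrite divr_gt0.
have uA : u * area C = semiperimeter C by rewrite /u divfK// gt_eqF.
have shC l : 0 < l -> is_shape (standard_indexing C l).
  by move=> l0; exact: shape_similitude l0 (similitude_scaling l) hC.
have aC l : 0 < l -> area (standard_indexing C l) = l ^+ 2 * area C.
  by move=> l0; exact: area_similitude l0 (similitude_scaling l) hC.
have pC l : 0 < l -> semiperimeter (standard_indexing C l) = l * semiperimeter C.
  by move=> l0; exact: semiperimeter_similitude l0 (similitude_scaling l) hC.
have lu l : 0 < l -> 0 < l * u by move=> l0; rewrite mulr_gt0.
have scM l m : scaling l @` standard_indexing C m = standard_indexing C (l * m).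
  rewrite /standard_indexing image_comp; congr (_ @` C); apply/funext => p.
  by rewrite /scaling/= !mulrA.
split; [split|..].
- split.
    split; first by move=> l /lu/shC.
    move=> k m k0 m0; apply/lambda_similarP; first by rewrite divr_gt0.
    exists (scaling (m / k)); first exact: similitude_scaling.
    by rewrite /D scM mulrA divfK// gt_eqF.
  move=> l l0; rewrite /D (pC _ (lu _ l0)).
  rewrite (_ : 2 * _ = 2 * (u ^+ 2 * area C) * l).
    by apply: is_derive_area => // t t0; rewrite (aC _ (lu _ t0)); ring.
  by rewrite -uA; ring.
- apply/seteqP; split=> X [l /= l0 <-].
    by exists (l * u); [exact: lu|].
  by exists (l / u); [rewrite /= divr_gt0|rewrite /D divfK// gt_eqF].
- by rewrite /D mul1r.
- split.
    split; first by exists 1 => //=.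
    by rewrite /D mul1r aC// pC// expr2 -mulrA uA.
  move=> X [[l /= l0 <-]]; rewrite /D (aC _ (lu _ l0)) (pC _ (lu _ l0)).
  rewrite exprMn -uA => H; suff -> : l = 1 by [].
  (* Comparing l^2 u^2 A with l u S = l u^2 A leaves l = 1. *)
  have lau : l * u ^+ 2 * area C != 0.
    by rewrite mulf_neq0 ?gt_eqF// mulr_gt0// exprn_gt0.
  apply: (mulIf lau); rewrite mul1r; transitivity (l ^+ 2 * u ^+ 2 * area C).
    by ring.
  by rewrite H; ring.
- by move=> l l0; rewrite /D [in RHS]/standard_indexing scM mul1r.
- move=> B [[shB simB] dB] [k k0 /congruentP[N sN CN]] l l0.
  have [M [sM NM MN]] := similitude_inv ltr01 sN.
  have BE t : 0 < t -> exists2 T, similitude (t / k) T & B t = T @` C.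
    move=> t0; have tk : 0 < t / k by rewrite divr_gt0.
    have /(lambda_similarP _ _ tk)[T sT BT] := simB _ _ k0 t0.
    exists (T \o M).
      by rewrite -(mulr1 (t / k)); apply: similitude_comp; rewrite // -invr1.
    rewrite BT CN image_comp; congr (_ @` _); apply/funext => p /=.
    by rewrite NM.
  have aB t : 0 < t -> area (B t) = area C / k ^+ 2 * t ^+ 2.
    move=> t0; have [T sT ->] := BE t t0.
    rewrite (area_similitude _ sT hC) ?divr_gt0//.
    by field; rewrite gt_eqF.
  have pB t : 0 < t -> semiperimeter (B t) = t / k * semiperimeter C.
    move=> t0; have [T sT ->] := BE t t0.
    by rewrite (semiperimeter_similitude _ sT hC) ?divr_gt0//.
  (* Comparing the derivative 2 A l / k^2 of the area with 2 S l / k. *)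
  have ku : k * u = 1.
    have d1 := dB l l0; have d2 := is_derive_area l0 aB.
    have : 2 * semiperimeter (B l) = 2 * (area C / k ^+ 2) * l.
      by rewrite -(@derive_val _ _ _ _ _ _ _ d1) (@derive_val _ _ _ _ _ _ _ d2).
    rewrite pB// -uA => H.
    have nz : 2 * (area C / k ^+ 2) * l != 0.
      by rewrite gt_eqF// !mulr_gt0// invr_gt0 exprn_gt0.
    apply: (mulIf nz); rewrite mul1r -[RHS]H; field; rewrite gt_eqF//.
  split.
    have [T sT ->] := BE l l0; apply: similitude_congruent sT _.
      by rewrite divr_gt0.
    have -> : l / k = l * u.
      apply: (mulIf (lt0r_neq0 k0)).
      by rewrite divfK ?gt_eqF// -mulrA (mulrC u) ku mulr1.
    exact: similitude_scaling.
  rewrite aB// pB// -uA.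
  have -> : area C / k ^+ 2 * l ^+ 2 / (l / k * (u * area C)) = l / (k * u).
    by field; rewrite !gt_eqF.
  by rewrite ku divr1.
- move=> U shU [k k0 /(lambda_similarP _ _ k0)[T sT UE]] AU.
  have ku : k = u.
    move: AU; rewrite UE (area_similitude k0 sT hC) (semiperimeter_similitude k0 sT hC).
    rewrite -uA => H; have nz : k * area C != 0 by rewrite mulf_neq0// gt_eqF.
    apply: (mulIf nz); transitivity (k ^+ 2 * area C); first by ring.
    by rewrite H; ring.
  rewrite UE /D mul1r; apply: similitude_congruent sT _ => //.
  by rewrite ku; exact: similitude_scaling.
Qed.
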